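(* Let $A$ be a local complete noetherian ring of dimension two satisfying Serre's condition $S_1$, and let $X=\mathrm{Spec}\,A$. Let $I\subseteq A$ be an ideal of height one. If $U=D(I)$ is connected and $\Gamma(U,\mathcal{O}_X)$ is of finite type over $A$, then $U$ is affine.
   Context: $D(I)=\mathrm{Spec}\,A\setminus V(I)$, regarded as an open subscheme of $X=\mathrm{Spec}\,A$. Condition $S_1$ means that every associated prime of $A$ is minimal. *)

(* Defs.v *)
From HB Require Import structures.
From mathcomp Require Import all_boot all_order all_algebra generic_quotient.
From mathcomp Require Import all_classical topology.
From mathcomp Require Import ring.

Set Implicit Arguments.
Unset Strict Implicit.
Unset Printing Implicit Defensive.

Import GRing.Theory.

Local Open Scope quotient_scope.
Local Open Scope classical_set_scope.
Local Open Scope ring_scope.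

(* Rings are possibly zero here, so that the ring of functions on the empty
   open set and the spectrum of the zero ring are covered. *)

Section Ideals.
Variable A : comPzRingType.
Implicit Types (I J : set A).

Definition is_ideal I : Prop :=
  [/\ I 0, forall x y, I x -> I y -> I (x + y) & forall a x, I x -> I (a * x)].

Definition is_prime I : Prop :=
  [/\ is_ideal I, ~ I 1 & forall a b, I (a * b) -> I a \/ I b].

Definition is_maximal I : Prop :=
  [/\ is_ideal I, ~ I 1 &
      forall J, is_ideal J -> ~ J 1 -> I `<=` J -> J = I].

Definition ideal_span (S : set A) : set A :=
  [set x | forall J, is_ideal J -> S `<=` J -> J x].

Definition ideal_mul I J : set A :=
  ideal_span [set x | exists a b, [/\ I a, J b & x = a * b]].

Fixpoint ideal_exp I (n : nat) : set A :=
  if n is m.+1 then ideal_mul I (ideal_exp I m) else setT.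

Definition annihilator (x : A) : set A := [set a | a * x = 0].

Definition noetherian : Prop :=
  forall I, is_ideal I -> exists s : seq A, I = ideal_span [set` s].

Definition local_with (m : set A) : Prop :=
  is_maximal m /\ forall n, is_maximal n -> n = m.

(* Completeness in the linear topology defined by the powers of [m]; it
   includes separatedness, i.e. it says that the canonical map from [A] to the
   inverse limit of the A/m^n is bijective. *)
Definition adically_complete (m : set A) : Prop :=
  (forall x, (forall n, ideal_exp m n x) -> x = 0) /\
  (forall u : nat -> A,
     (forall n, exists N, forall i j, (N <= i)%N -> (N <= j)%N ->
        ideal_exp m n (u i - u j)) ->
     exists l, forall n, exists N, forall i, (N <= i)%N ->
        ideal_exp m n (u i - l)).

Definition complete_local : Prop :=
  exists2 m, local_with m & adically_complete m.

(* the chain c 0 < c 1 < ... < c n has length n; c is irrelevant beyond n *)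
Definition prime_chain (n : nat) (c : nat -> set A) : Prop :=
  (forall i, (i <= n)%N -> is_prime (c i)) /\
  (forall i, (i < n)%N -> c i `<` c i.+1).

Definition has_krull_dim (n : nat) : Prop :=
  (exists c, prime_chain n c) /\ (forall k c, prime_chain k c -> (k <= n)%N).

Definition prime_has_height (p : set A) (n : nat) : Prop :=
  (exists2 c, prime_chain n c & c n = p) /\
  (forall k c, prime_chain k c -> c k = p -> (k <= n)%N).

(* The height of an ideal is the minimum of the heights of the primes
   containing it; a prime of infinite height has no [prime_has_height]. *)
Definition has_height I (n : nat) : Prop :=
  (exists p, [/\ is_prime p, I `<=` p & prime_has_height p n]) /\
  (forall p k, is_prime p -> I `<=` p -> prime_has_height p k -> (n <= k)%N).

Definition associated_prime (p : set A) : Prop :=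
  is_prime p /\ exists x, p = annihilator x.

Definition minimal_prime (p : set A) : Prop :=
  is_prime p /\ forall q, is_prime q -> q `<=` p -> q = p.

Definition serre_S1 : Prop := forall p, associated_prime p -> minimal_prime p.

End Ideals.

Arguments noetherian A : clear implicits.
Arguments complete_local A : clear implicits.
Arguments has_krull_dim A n : clear implicits.
Arguments serre_S1 A : clear implicits.

Record Spec (A : comPzRingType) : Type := MkSpec {
  pt_ideal : set A;
  pt_prime : is_prime pt_ideal }.

HB.instance Definition _ (A : comPzRingType) := gen_eqMixin (Spec A).
HB.instance Definition _ (A : comPzRingType) := gen_choiceMixin (Spec A).

Definition V_ (A : comPzRingType) (S : set A) : set (Spec A) :=
  [set x | S `<=` pt_ideal x].

Definition D_ (A : comPzRingType) (S : set A) : set (Spec A) := ~` V_ S.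

Section Zariski.
Variable A : comPzRingType.

Definition zariski_open (U : set (Spec A)) : Prop := exists S : set A, U = D_ S.

Lemma D_P (S : set A) x : D_ S x <-> exists2 a, S a & ~ pt_ideal x a.
Proof.
split; last by move=> [a Sa xa] /(_ a Sa).
by move=> /existsNP[a /not_implyP[Sa xa]]; exists a.
Qed.

Lemma zariski_openT : zariski_open setT.
Proof.
exists setT; apply/seteqP; split=> // x _; apply/D_P; exists 1 => //.
by case: (pt_prime x).
Qed.

Lemma zariski_openI : setI_closed zariski_open.
Proof.
move=> _ _ [S ->] [T ->].
exists [set c | exists a b, [/\ S a, T b & c = a * b]].
apply/seteqP; split=> x.
  move=> [/D_P[a Sa xa] /D_P[b Tb xb]]; apply/D_P; exists (a * b).
    by exists a, b.
  by case: (pt_prime x) => _ _ H /H[].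
move=> /D_P[_ [a [b [Sa Tb ->]]] xab].
case: (pt_prime x) => -[_ _ xM] _ _.
split; apply/D_P; [exists a | exists b] => // H; apply: xab; last exact: xM.
by rewrite mulrC; exact: xM.
Qed.

Lemma zariski_open_bigU (I : Type) (f : I -> set (Spec A)) :
  (forall i, zariski_open (f i)) -> zariski_open (\bigcup_i f i).
Proof.
move=> fo; exists [set a | exists S i, S a /\ f i = D_ S].
apply/seteqP; split=> x.
  move=> [i _]; case: (fo i) => S fS; rewrite fS => /D_P[a Sa xa].
  by apply/D_P; exists a => //; exists S, i.
move=> /D_P[a [S [i [Sa fS]]] xa]; exists i => //; rewrite fS.
by apply/D_P; exists a.
Qed.

End Zariski.

HB.instance Definition _ (A : comPzRingType) :=
  isOpenTopological.Build (Spec A) (@zariski_openT A) (@zariski_openI A)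
    (@zariski_open_bigU A).

Lemma open_D (A : comPzRingType) (S : set A) : open (D_ S).
Proof. by exists S. Qed.

Section Localization.
Variables (A : comPzRingType) (x : Spec A).

Definition denom : Type := {s : A | `[< ~ pt_ideal x s >]}.
HB.instance Definition _ := Choice.on denom.

Lemma denomP (s : denom) : ~ pt_ideal x (val s).
Proof. exact/asboolP/(valP s). Qed.

Definition mk_denom (s : A) (hs : ~ pt_ideal x s) : denom :=
  exist _ s (introT (asboolP _) hs).

Lemma denom1_proof : ~ pt_ideal x 1.
Proof. by case: (pt_prime x). Qed.

Lemma denomM_proof s t :
  ~ pt_ideal x s -> ~ pt_ideal x t -> ~ pt_ideal x (s * t).
Proof. by case: (pt_prime x) => _ _ H xs xt /H[]. Qed.

Definition denom1 : denom := mk_denom denom1_proof.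
Definition denomM (s t : denom) : denom :=
  mk_denom (denomM_proof (@denomP s) (@denomP t)).

Definition prefrac : Type := (A * denom)%type.
HB.instance Definition _ := Choice.on prefrac.

Definition frac_eq (u v : prefrac) : bool :=
  `[< exists2 w, ~ pt_ideal x w &
        w * (u.1 * val v.2 - v.1 * val u.2) = 0 >].

Lemma frac_eq_refl : reflexive frac_eq.
Proof.
by move=> u; apply/asboolP; exists 1; [exact: denom1_proof | rewrite subrr mulr0].
Qed.

Lemma frac_eq_sym : symmetric frac_eq.
Proof.
move=> u v; apply/asboolP/asboolP => -[w xw e]; exists w => //;
by rewrite -opprB mulrN e oppr0.
Qed.

Lemma frac_eq_trans : transitive frac_eq.
Proof.
move=> v u t /asboolP[w xw e] /asboolP[w' xw' e']; apply/asboolP.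
exists (w * w' * val v.2).
  by apply: denomM_proof; [exact: denomM_proof | exact: denomP].
transitivity (w' * val t.2 * (w * (u.1 * val v.2 - v.1 * val u.2)) +
    w * val u.2 * (w' * (v.1 * val t.2 - t.1 * val v.2))); first by ring.
by rewrite e e' !mulr0 addr0.
Qed.

Canonical frac_equiv :=
  EquivRel frac_eq frac_eq_refl frac_eq_sym frac_eq_trans.

Definition local_ring : Type := {eq_quot frac_eq}.
HB.instance Definition _ := Choice.on local_ring.
HB.instance Definition _ := EqQuotient.on local_ring.


Lemma pi_fracP (u v : prefrac) :
  (\pi_local_ring u = \pi_local_ring v) <-> frac_eq u v.
Proof. by split=> [/eqmodP|h]; [|apply/eqmodP]. Qed.

Lemma pi_frac_cross (u v : prefrac) :
  u.1 * val v.2 = v.1 * val u.2 -> \pi_local_ring u = \pi_local_ring v.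
Proof.
move=> e; apply/pi_fracP/asboolP; exists 1; first exact: denom1_proof.
by rewrite e subrr mulr0.
Qed.

Lemma frac_eq_repr (u : prefrac) : frac_eq (repr (\pi_local_ring u)) u.
Proof. by apply/pi_fracP; rewrite reprK. Qed.

Definition prefrac_add (u v : prefrac) : prefrac :=
  (u.1 * val v.2 + v.1 * val u.2, denomM u.2 v.2).
Definition prefrac_opp (u : prefrac) : prefrac := (- u.1, u.2).
Definition prefrac_mul (u v : prefrac) : prefrac :=
  (u.1 * v.1, denomM u.2 v.2).

Definition local_add (f g : local_ring) : local_ring :=
  \pi_local_ring (prefrac_add (repr f) (repr g)).
Definition local_opp (f : local_ring) : local_ring :=
  \pi_local_ring (prefrac_opp (repr f)).
Definition local_mul (f g : local_ring) : local_ring :=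
  \pi_local_ring (prefrac_mul (repr f) (repr g)).
Definition local_zero : local_ring := \pi_local_ring (0, denom1).
Definition local_one : local_ring := \pi_local_ring (1, denom1).

Lemma local_addE u v :
  local_add (\pi_local_ring u) (\pi_local_ring v) = \pi_local_ring (prefrac_add u v).
Proof.
have /asboolP[w xw e] := frac_eq_repr u.
have /asboolP[w' xw' e'] := frac_eq_repr v.
apply/pi_fracP/asboolP; exists (w * w'); first exact: denomM_proof.
rewrite /prefrac_add /=.
move: (repr _) (repr _) e e' => v' u' e e'.
transitivity (w' * val v'.2 * val v.2 * (w * (u'.1 * val u.2 - u.1 * val u'.2))
  + w * val u'.2 * val u.2 * (w' * (v'.1 * val v.2 - v.1 * val v'.2))).
  by rewrite /=; ring.
by rewrite e e' !mulr0 addr0.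
Qed.

Lemma local_oppE u : local_opp (\pi_local_ring u) = \pi_local_ring (prefrac_opp u).
Proof.
have /asboolP[w xw e] := frac_eq_repr u.
apply/pi_fracP/asboolP; exists w => //=.
move: (repr _) e => u' e.
transitivity (- (w * (u'.1 * val u.2 - u.1 * val u'.2))).
  by rewrite /=; ring.
by rewrite e oppr0.
Qed.

Lemma local_mulE u v :
  local_mul (\pi_local_ring u) (\pi_local_ring v) = \pi_local_ring (prefrac_mul u v).
Proof.
have /asboolP[w xw e] := frac_eq_repr u.
have /asboolP[w' xw' e'] := frac_eq_repr v.
apply/pi_fracP/asboolP; exists (w * w'); first exact: denomM_proof.
rewrite /prefrac_mul /=.
move: (repr _) (repr _) e e' => v' u' e e'.
transitivity (w' * v'.1 * val v.2 * (w * (u'.1 * val u.2 - u.1 * val u'.2))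
  + w * u.1 * val u'.2 * (w' * (v'.1 * val v.2 - v.1 * val v'.2))).
  by rewrite /=; ring.
by rewrite e e' !mulr0 addr0.
Qed.

Lemma local_addA : associative local_add.
Proof.
elim/quotW=> f; elim/quotW=> g; elim/quotW=> h.
rewrite (local_addE g h) (local_addE f) (local_addE f g) local_addE.
by apply: pi_frac_cross => /=; ring.
Qed.

Lemma local_addC : commutative local_add.
Proof.
elim/quotW=> f; elim/quotW=> g; rewrite (local_addE f) (local_addE g).
by apply: pi_frac_cross => /=; ring.
Qed.

Lemma local_add0 : left_id local_zero local_add.
Proof.
elim/quotW=> f; rewrite local_addE.
by apply: pi_frac_cross => /=; ring.
Qed.

Lemma local_addN : left_inverse local_zero local_opp local_add.
Proof.
elim/quotW=> f; rewrite (local_oppE f) local_addE.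
by apply: pi_frac_cross => /=; ring.
Qed.

Lemma local_mulA : associative local_mul.
Proof.
elim/quotW=> f; elim/quotW=> g; elim/quotW=> h.
rewrite (local_mulE g h) (local_mulE f) (local_mulE f g) local_mulE.
by apply: pi_frac_cross => /=; ring.
Qed.

Lemma local_mulC : commutative local_mul.
Proof.
elim/quotW=> f; elim/quotW=> g; rewrite (local_mulE f) (local_mulE g).
by apply: pi_frac_cross => /=; ring.
Qed.

Lemma local_mul1 : left_id local_one local_mul.
Proof.
elim/quotW=> f; rewrite local_mulE.
by apply: pi_frac_cross => /=; ring.
Qed.

Lemma local_mulD : left_distributive local_mul local_add.
Proof.
elim/quotW=> f; elim/quotW=> g; elim/quotW=> h.
rewrite (local_addE f g) (local_mulE f h) (local_mulE g h) local_mulE local_addE.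
by apply: pi_frac_cross => /=; ring.
Qed.

HB.instance Definition _ := GRing.isZmodule.Build local_ring
  local_addA local_addC local_add0 local_addN.
HB.instance Definition _ := GRing.Zmodule_isComPzRing.Build local_ring
  local_mulA local_mulC local_mul1 local_mulD.

(* the element a/s *)
Definition frac (a : A) (s : A) (hs : ~ pt_ideal x s) : local_ring :=
  \pi_local_ring (a, mk_denom hs).

Lemma frac0 : 0 = frac 0 denom1_proof. Proof. by []. Qed.
Lemma frac1 : 1 = frac 1 denom1_proof. Proof. by []. Qed.

Lemma fracD a s hs b t ht : @frac a s hs + @frac b t ht =
  frac (a * t + b * s) (denomM_proof hs ht).
Proof. by rewrite [LHS]local_addE; apply: pi_frac_cross. Qed.

Lemma fracN a s hs : - @frac a s hs = frac (- a) hs.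
Proof. by rewrite [LHS]local_oppE. Qed.

Lemma fracM a s hs b t ht : @frac a s hs * @frac b t ht =
  frac (a * b) (denomM_proof hs ht).
Proof. by rewrite [LHS]local_mulE; apply: pi_frac_cross. Qed.

Lemma fracP a s hs b t ht : @frac a s hs = @frac b t ht <->
  exists2 w, ~ pt_ideal x w & w * (a * t - b * s) = 0.
Proof. by rewrite pi_fracP; split=> [/asboolP|?]; last apply/asboolP. Qed.

End Localization.

Section StructureSheaf.
Variables (A : comPzRingType) (U : set (Spec A)).

(* Locally around each point of U, the function s is given by one fraction
   a/f with f vanishing nowhere on that neighbourhood. *)
Definition locally_fraction (s : forall x : U, local_ring (val x)) : Prop :=
  forall x : U, exists V : set (Spec A), [/\ open V, V (val x) &
    exists a f : A, forall y : U, V (val y) ->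
      exists hf : ~ pt_ideal (val y) f, s y = frac a hf].

Record sections : Type := MkSections {
  section_fun :> forall x : U, local_ring (val x);
  sectionP : locally_fraction section_fun }.

HB.instance Definition _ := gen_eqMixin sections.
HB.instance Definition _ := gen_choiceMixin sections.

Lemma section_ext (s t : sections) : (forall x, s x = t x) -> s = t.
Proof.
case: s t => s hs [t ht] /= st.
have {}st : s = t by exact: functional_extensionality_dep.
by case: _ / st ht => ht; congr MkSections; exact: Prop_irrelevance.
Qed.

Lemma const_section_proof (a : A) :
  locally_fraction (fun x => frac a (@denom1_proof A (val x))).
Proof.
move=> x; exists setT; split=> //; first exact: openT.
by exists a, 1 => y _; exists (@denom1_proof _ _).
Qed.

Definition const_section (a : A) : sections := MkSections (const_section_proof a).

Lemma section_add_proof (s t : sections) :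
  locally_fraction (fun x => s x + t x).
Proof.
move=> x; have [V [oV Vx [a [f sE]]]] := sectionP s x.
have [W [oW Wx [b [g tE]]]] := sectionP t x.
exists (V `&` W); split=> //; first exact: openI.
exists (a * g + b * f), (f * g) => y [/sE[hf ->] /tE[hg ->]].
by rewrite fracD; exists (denomM_proof hf hg).
Qed.

Lemma section_mul_proof (s t : sections) :
  locally_fraction (fun x => s x * t x).
Proof.
move=> x; have [V [oV Vx [a [f sE]]]] := sectionP s x.
have [W [oW Wx [b [g tE]]]] := sectionP t x.
exists (V `&` W); split=> //; first exact: openI.
exists (a * b), (f * g) => y [/sE[hf ->] /tE[hg ->]].
by rewrite fracM; exists (denomM_proof hf hg).
Qed.

Lemma section_opp_proof (s : sections) : locally_fraction (fun x => - s x).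
Proof.
move=> x; have [V [oV Vx [a [f sE]]]] := sectionP s x.
exists V; split=> //; exists (- a), f => y /sE[hf ->].
by rewrite fracN; exists hf.
Qed.

Definition section_add s t := MkSections (section_add_proof s t).
Definition section_opp s := MkSections (section_opp_proof s).
Definition section_mul s t := MkSections (section_mul_proof s t).

Lemma section_addA : associative section_add.
Proof. by move=> *; apply: section_ext => x /=; rewrite addrA. Qed.
Lemma section_addC : commutative section_add.
Proof. by move=> *; apply: section_ext => x /=; rewrite addrC. Qed.
Lemma section_add0 : left_id (const_section 0) section_add.
Proof. by move=> *; apply: section_ext => x /=; rewrite -frac0 add0r. Qed.
Lemma section_addN : left_inverse (const_section 0) section_opp section_add.
Proof. by move=> *; apply: section_ext => x /=; rewrite addNr frac0. Qed.
Lemma section_mulA : associative section_mul.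
Proof. by move=> *; apply: section_ext => x /=; rewrite mulrA. Qed.
Lemma section_mulC : commutative section_mul.
Proof. by move=> *; apply: section_ext => x /=; rewrite mulrC. Qed.
Lemma section_mul1 : left_id (const_section 1) section_mul.
Proof. by move=> *; apply: section_ext => x /=; rewrite -frac1 mul1r. Qed.
Lemma section_mulD : left_distributive section_mul section_add.
Proof. by move=> *; apply: section_ext => x /=; rewrite mulrDl. Qed.

HB.instance Definition _ := GRing.isZmodule.Build sections
  section_addA section_addC section_add0 section_addN.
HB.instance Definition _ := GRing.Zmodule_isComPzRing.Build sections
  section_mulA section_mulC section_mul1 section_mulD.

Lemma const_section_zmod : zmod_morphism const_section.
Proof.
move=> a b; apply: section_ext => x /=.
rewrite fracN fracD; apply/fracP; exists 1; first exact: denom1_proof.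
by rewrite !mulr1 subrr mulr0.
Qed.

Lemma const_section_monoid : monoid_morphism const_section.
Proof.
split=> // a b; apply: section_ext => x /=.
rewrite fracM; apply/fracP; exists 1; first exact: denom1_proof.
by rewrite !mulr1 subrr mulr0.
Qed.

HB.instance Definition _ := GRing.isZmodMorphism.Build A sections
  const_section const_section_zmod.
HB.instance Definition _ := GRing.isMonoidMorphism.Build A sections
  const_section const_section_monoid.

End StructureSheaf.

Arguments const_section {A} U.

Section Restriction.
Variables (A : comPzRingType) (U V : set (Spec A)) (sVU : V `<=` U).

Definition incl_set (x : V) : U :=
  exist _ (val x) (mem_set (sVU (set_mem (valP x)))).

Lemma restrict_proof (s : sections U) :
  locally_fraction (fun x : V => s (incl_set x)).
Proof.
move=> x; have [W [oW Wx [a [f sE]]]] := sectionP s (incl_set x).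
by exists W; split=> //; exists a, f => y /(sE (incl_set y)).
Qed.

Definition restrict (s : sections U) : sections V :=
  MkSections (restrict_proof s).

Lemma restrict_zmod : zmod_morphism restrict.
Proof. by move=> s t; apply: section_ext. Qed.

Lemma restrict_monoid : monoid_morphism restrict.
Proof. by split=> [|s t]; apply: section_ext. Qed.

HB.instance Definition _ := GRing.isZmodMorphism.Build (sections U) (sections V)
  restrict restrict_zmod.
HB.instance Definition _ := GRing.isMonoidMorphism.Build
  (sections U) (sections V) restrict restrict_monoid.

End Restriction.

(* The presheaf is given on all subsets for convenience; only its values on
   open subsets matter, and only these occur in the gluing axiom and in the
   notion of isomorphism below. *)
Record ringed_space : Type := RingedSpace {
  rs_space :> topologicalType;
  rs_sec : set rs_space -> comPzRingType;
  rs_res : forall U V : set rs_space,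
    V `<=` U -> {rmorphism rs_sec U -> rs_sec V};
  rs_res_id : forall U (h : U `<=` U) s, rs_res h s = s;
  rs_res_comp : forall U V W (h : V `<=` U) (k : W `<=` V) (l : W `<=` U) s,
    rs_res k (rs_res h s) = rs_res l s;
  rs_glue : forall (U : set rs_space) (I : Type) (F : I -> set rs_space)
      (FU : forall i, F i `<=` U),
    open U -> (forall i, open (F i)) -> U `<=` \bigcup_i F i ->
    forall s : (forall i, rs_sec (F i)),
      (forall i j, rs_res (@subIsetl _ (F i) (F j)) (s i) =
                   rs_res (@subIsetr _ (F i) (F j)) (s j)) ->
      exists! t : rs_sec U, forall i, rs_res (FU i) t = s i }.

Section SpecRingedSpace.
Variable A : comPzRingType.

Lemma restrict_id (U : set (Spec A)) (h : U `<=` U) s : restrict h s = s.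
Proof.
apply: section_ext => -[x xU] /=; rewrite /incl_set /=.
by congr (s (exist _ x _)); exact: Prop_irrelevance.
Qed.

Lemma restrict_comp (U V W : set (Spec A)) (h : V `<=` U) (k : W `<=` V)
  (l : W `<=` U) s : restrict k (restrict h s) = restrict l s.
Proof.
apply: section_ext => -[x xU] /=; rewrite /incl_set /=.
by congr (s (exist _ x _)); exact: Prop_irrelevance.
Qed.

Lemma sections_glue (U : set (Spec A)) (I : Type) (F : I -> set (Spec A))
    (FU : forall i, F i `<=` U) :
  open U -> (forall i, open (F i)) -> U `<=` \bigcup_i F i ->
  forall s : (forall i, sections (F i)),
    (forall i j, restrict (@subIsetl _ (F i) (F j)) (s i) =
                 restrict (@subIsetr _ (F i) (F j)) (s j)) ->
    exists! t : sections U, forall i, restrict (FU i) t = s i.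
Proof.
move=> oU oF UF s sE.
have sE' i j (x : Spec A) (xi : x \in F i) (xj : x \in F j) :
    s i (exist _ x xi) = s j (exist _ x xj).
  have xij : x \in F i `&` F j by rewrite in_setI xi xj.
  have e := congr1 (fun u : sections _ => u (exist _ x xij)) (sE i j).
  transitivity (s i (incl_set (@subIsetl _ (F i) (F j)) (exist _ x xij))).
    by congr (s i (exist _ x _)); exact: Prop_irrelevance.
  transitivity (s j (incl_set (@subIsetr _ (F i) (F j)) (exist _ x xij))).
    exact: e.
  by congr (s j (exist _ x _)); exact: Prop_irrelevance.
have pick_i (x : U) : {i : I | val x \in F i}.
  apply: cid; have [i _ Fi] := UF _ (set_mem (valP x)).
  by exists i; exact: mem_set.
pose t0 (x : U) : local_ring (val x) := s (sval (pick_i x)) (exist _ (val x) (svalP (pick_i x))).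
have t0E i (x : U) (xi : val x \in F i) : t0 x = s i (exist _ (val x) xi).
  exact: sE'.
have t0P : locally_fraction t0.
  move=> x; set i := sval (pick_i x).
  have xi : val x \in F i := svalP (pick_i x).
  have [W [oW Wx [a [f sW]]]] := sectionP (s i) (exist _ (val x) xi).
  exists (W `&` F i); split; [exact: openI | by split=> //; exact: set_mem|].
  exists a, f => y [Wy /mem_set yi]; rewrite (t0E i y yi).
  exact: (sW (exist _ (val y) yi)).
exists (MkSections t0P); split.
  move=> i; apply: section_ext => -[x xi] /=.
  exact: (t0E i (incl_set (FU i) (exist _ x xi))).
move=> t tE; apply: section_ext => x /=; rewrite /t0.
move: (pick_i x) => [i xi] /=.
rewrite -(tE i) /= /incl_set /=; move: (mem_set _) => xU'.
case: x xi xU' => x xU /= _ xU'.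
by congr (t (exist _ x _)); exact: Prop_irrelevance.
Qed.

Definition Spec_space : ringed_space :=
  @RingedSpace (Spec A) (fun U => sections U : comPzRingType)
    (fun U V h => restrict h : {rmorphism sections U -> sections V})
    restrict_id restrict_comp sections_glue.

End SpecRingedSpace.


Section OpenSubspace.
Variables (X : ringed_space) (U : set X) (oU : open U).

Definition sub_sec (W : set U) : comPzRingType := rs_sec (val @` W).

Definition sub_res (V W : set U) (h : W `<=` V) :
  {rmorphism sub_sec V -> sub_sec W} := rs_res (image_subset val h).

Lemma sub_res_id (V : set U) (h : V `<=` V) s : sub_res h s = s.
Proof. exact: rs_res_id. Qed.

Lemma sub_res_comp (V W T : set U) (h : W `<=` V) (k : T `<=` W)
  (l : T `<=` V) s : sub_res k (sub_res h s) = sub_res l s.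
Proof. exact: rs_res_comp. Qed.

Lemma open_sub_image (W : set U) : open W -> open (val @` W).
Proof.
move=> [V oV <-]; rewrite [X in open X](_ : _ = V `&` U); first exact: openI.
apply/seteqP; split=> [_ [x Vx <-]|x [Vx Ux]].
  by split=> //; exact: set_mem (valP x).
by exists (exist _ x (mem_set Ux)).
Qed.

Lemma sub_glue (V : set U) (I : Type) (F : I -> set U)
    (FV : forall i, F i `<=` V) :
  open V -> (forall i, open (F i)) -> V `<=` \bigcup_i F i ->
  forall s : (forall i, sub_sec (F i)),
    (forall i j, sub_res (@subIsetl _ (F i) (F j)) (s i) =
                 sub_res (@subIsetr _ (F i) (F j)) (s j)) ->
    exists! t : sub_sec V, forall i, sub_res (FV i) t = s i.
Proof.
move=> oV oF VF s sE; apply: rs_glue.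
- exact: open_sub_image.
- by move=> i; exact: open_sub_image.
- move=> _ [x Vx <-]; have [i _ Fix] := VF _ Vx.
  by exists i => //; exists x.
move=> i j.
have h : val @` F i `&` val @` F j `<=` val @` (F i `&` F j).
  by move=> _ [[x Fx <-] [y Fy /val_inj xy]]; exists x => //; split=> //; rewrite -xy.
have /(congr1 (rs_res h)) := sE i j.
rewrite /sub_res.
rewrite (rs_res_comp _ _ (@subIsetl _ (val @` F i) (val @` F j))).
by rewrite (rs_res_comp _ _ (@subIsetr _ (val @` F i) (val @` F j))).
Qed.

Definition open_subspace : ringed_space :=
  @RingedSpace U sub_sec sub_res sub_res_id sub_res_comp sub_glue.

End OpenSubspace.

(* An isomorphism of ringed spaces: a homeomorphism together with ring
   isomorphisms on open sets that commute with restriction.  Between locally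
   ringed spaces this is the same as an isomorphism of locally ringed spaces
   (the induced isomorphisms of stalks are automatically local), so for schemes
   it is an isomorphism of schemes. *)
Record rs_iso (X Y : ringed_space) : Type := RsIso {
  iso_fun : X -> Y;
  iso_inv : Y -> X;
  iso_funK : cancel iso_fun iso_inv;
  iso_invK : cancel iso_inv iso_fun;
  iso_fun_cont : continuous iso_fun;
  iso_inv_cont : continuous iso_inv;
  iso_sec : forall V : set Y, open V ->
    {rmorphism rs_sec V -> rs_sec (iso_fun @^-1` V)};
  iso_sec_bij : forall (V : set Y) (oV : open V), bijective (iso_sec oV);
  iso_sec_res : forall (V W : set Y) (oV : open V) (oW : open W)
      (h : W `<=` V) (s : rs_sec V),
    iso_sec oW (rs_res h s) = rs_res (preimage_subset h) (iso_sec oV s) }.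

Definition is_affine (X : ringed_space) : Prop :=
  exists B : comPzRingType, inhabited (rs_iso X (Spec_space B)).

(* B, regarded as an A-algebra through phi, is generated by finitely many
   elements: every subring of B containing the image of phi and these elements
   is B. *)
Definition finite_type (A B : comPzRingType) (phi : {rmorphism A -> B}) : Prop :=
  exists gens : seq B, forall S : {pred B}, subring_closed S ->
    (forall a, phi a \in S) -> {subset gens <= S} -> forall b, b \in S.

(* Main.v *)
Require Import Defs.
From HB Require Import structures.
From mathcomp Require Import all_boot all_order all_algebra.
From mathcomp Require Import all_classical topology.
From mathcomp Require Import ring.
(* [frac] must mean the one of Defs, not that of the fraction library *)
Require Import Defs.

(* Let B be the ring of functions on U = D(I) and m the maximal ideal of A. If
   IB = B, then U is isomorphic to Spec B by P |-> P :&: A. By condition S1, I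
   contains a regular element f of A, and B is contained in A[1/f].

   A prime p <> m containing I is minimal over f because dim A = 2, so that
   s I^k <= fA for some s outside p; then s/f is a function on U, and s lies in
   IB. Hence m^k <= IB for some k. The same local divisibility gives g in I such
   that f, g is a regular sequence on B, and an argument of Krull-Akizuki type
   for B/fB shows that B/mB is finite over A. Let N be the intersection of the
   m^n B. As A is complete, B/N is a finite A-module; as B is noetherian, some
   d = 1 mod mB kills N, and d is a unit modulo N by Nakayama, so N is generated
   by an idempotent. U being connected, N = B or N = 0. In the first case
   B = m^k B <= IB. In the second case B is finite over A, so the elements of
   IB :&: A lie in the radical of I by Cayley-Hamilton; then a height one prime
   containing I contains m^k, which is absurd. *)

Set Implicit Arguments.
Unset Strict Implicit.
Unset Printing Implicit Defensive.

Import GRing.Theory.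

Local Open Scope classical_set_scope.
Local Open Scope ring_scope.

(** * Ideals of noetherian rings *)

(** Finite type makes B noetherian but not finite over A, and mB need not lie in the Jacobson
    radical of B. So generators of B/mB do not lift by Nakayama: completeness gives generators only
    modulo N, and Krull's theorem gives an element that kills N rather than N = 0. This loss is
    inherent, since N = B is the case that occurs and N = 0 the one to be refuted; connectedness
    excludes a mixture of the two. The recurrent device is an ideal maximal for a suitable property
    ([noetherian_max]): it produces primes, powers of an ideal inside another, associated primes,
    and the ideal Q in Krull's theorem. *)

Lemma ascending_le (T : Type) (c : nat -> set T) : (forall n, c n `<=` c n.+1) ->
  forall m n, (m <= n)%N -> c m `<=` c n.
Proof.
move=> cS m n; elim: n => [|n IH]; first by rewrite leqn0 => /eqP->.
rewrite leq_eqVlt ltnS => /orP[/eqP->//|/IH h]; exact: subset_trans (cS n).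
Qed.

Section IdealTheory.
Variable A : comPzRingType.
Implicit Types (I J K L P : set A) (S : set A).

Lemma ideal_span_ideal S : is_ideal (ideal_span S).
Proof.
split=> [J [] //|x y Sx Sy J Ji SJ|a x Sx J Ji SJ]; case: (Ji) => _ JD JM.
  by apply: JD; [exact: Sx | exact: Sy].
by apply: JM; exact: Sx.
Qed.

Lemma sub_ideal_span S : S `<=` ideal_span S.
Proof. by move=> x Sx J _; apply. Qed.

Lemma ideal_span_sub S J : is_ideal J -> S `<=` J -> ideal_span S `<=` J.
Proof. by move=> Ji SJ x; apply. Qed.

Lemma ideal_add J x y : is_ideal J -> J x -> J y -> J (x + y).
Proof. by case=> _ JD _; exact: JD. Qed.

Lemma ideal_mull J a x : is_ideal J -> J x -> J (a * x).
Proof. by case=> _ _ JM; exact: JM. Qed.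

Lemma ideal_mulr J a x : is_ideal J -> J x -> J (x * a).
Proof. by rewrite mulrC; exact: ideal_mull. Qed.

Lemma ideal_opp J x : is_ideal J -> J x -> J (- x).
Proof. by move=> Ji Jx; rewrite -mulN1r; exact: ideal_mull. Qed.

Lemma ideal_sub J x y : is_ideal J -> J x -> J y -> J (x - y).
Proof. by move=> Ji Jx Jy; apply: ideal_add => //; exact: ideal_opp. Qed.

Lemma ideal_sum J (T : Type) (r : seq T) (F : T -> A) :
  is_ideal J -> (forall t, J (F t)) -> J (\sum_(t <- r) F t).
Proof.
by move=> Ji JF; apply: big_ind => // [|x y]; [case: Ji | exact: ideal_add].
Qed.

Lemma ideal_eqT J : is_ideal J -> J 1 -> J = setT.
Proof.
by move=> Ji J1; apply/seteqP; split=> // x _; rewrite -[x]mulr1; exact: ideal_mull.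
Qed.

Lemma ideal_setT : is_ideal (setT : set A). Proof. by []. Qed.

Lemma primeX P x n : is_prime P -> P (x ^+ n) -> P x.
Proof.
move=> [_ P1 PM]; elim: n => [|n IH]; first by rewrite expr0 => /P1.
by rewrite exprS => /PM[].
Qed.

Lemma primeNX P x n : is_prime P -> ~ P x -> ~ P (x ^+ n).
Proof. by move=> Pp Px /(primeX Pp). Qed.

Lemma primeNM P x y : is_prime P -> ~ P x -> ~ P y -> ~ P (x * y).
Proof. by move=> [_ _ PM] Px Py /PM[]. Qed.

Definition principal_ext J a : set A := [set x | exists p c, J p /\ x = p + a * c].

Lemma principal_ext_ideal J a : is_ideal J -> is_ideal (principal_ext J a).
Proof.
move=> Ji; split.
- by exists 0, 0; split; [case: Ji | ring].
- move=> _ _ [p [c [Jp ->]]] [q [d [Jq ->]]]; exists (p + q), (c + d).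
  by split; [exact: ideal_add | ring].
- move=> b _ [p [c [Jp ->]]]; exists (b * p), (b * c).
  by split; [exact: ideal_mull | ring].
Qed.

Lemma principal_ext_sub J a : J `<=` principal_ext J a.
Proof. by move=> x Jx; exists x, 0; split => //; ring. Qed.

Lemma principal_ext_mem J a : is_ideal J -> principal_ext J a a.
Proof. by case=> J0 _ _; exists 0, 1; split => //; ring. Qed.

(** The annihilator of the class of [x] in A/J; when prime, an associated prime of A/J. *)
Definition colon J x : set A := [set a | J (a * x)].

Lemma colon_ideal J x : is_ideal J -> is_ideal (colon J x).
Proof.
move=> Ji; split; rewrite /colon /=.
- by rewrite mul0r; case: Ji.
- by move=> a b Ja Jb; rewrite mulrDl; exact: ideal_add.
- by move=> a b Jb; rewrite -mulrA; exact: ideal_mull.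
Qed.

Lemma sub_colon J x : is_ideal J -> J `<=` colon J x.
Proof. by move=> Ji a Ja; exact: ideal_mulr. Qed.

Lemma bigcup_ideal (c : nat -> set A) : (forall n, is_ideal (c n)) ->
  (forall n, c n `<=` c n.+1) -> is_ideal (\bigcup_n c n).
Proof.
move=> ci cS.
have cle := ascending_le cS.
split; first by exists 0%N => //; case: (ci 0%N).
- move=> x y [m _ mx] [n _ ny]; exists (maxn m n) => //; apply: ideal_add => //.
    by apply: cle mx; exact: leq_maxl.
  by apply: cle ny; exact: leq_maxr.
- by move=> a x [m _ mx]; exists m => //; exact: ideal_mull.
Qed.

Lemma noetherian_acc (c : nat -> set A) : noetherian A ->
  (forall n, is_ideal (c n)) -> (forall n, c n `<=` c n.+1) ->
  exists n, forall k, (n <= k)%N -> c k `<=` c n.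
Proof.
move=> An ci cS; have [s sE] := An _ (bigcup_ideal ci cS).
suff [n sn] : exists n, [set` s] `<=` c n.
  exists n => k _ x ckx; apply: ideal_span_sub sn _ _ => //.
  by rewrite -sE; exists k.
have : [set` s] `<=` \bigcup_n c n by rewrite sE; exact: sub_ideal_span.
elim: s {sE} => [_|a s IH sc]; first by exists 0%N.
have [n sn] : exists n, [set` s] `<=` c n.
  by apply: IH => x xs; apply: sc; rewrite /= in_cons; apply/orP; right.
have [m _ ma] : (\bigcup_n c n) a by apply: sc; rewrite /= mem_head.
exists (maxn m n) => x /=; rewrite in_cons => /orP[/eqP->|xs].
  by apply: (ascending_le cS _ ma); exact: leq_maxl.
by apply: (ascending_le cS _ (sn x xs)); exact: leq_maxr.
Qed.

(** Without a maximal member, dependent choice builds a strictly ascending chain. *)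
Lemma noetherian_max (F : set A -> Prop) J0 : noetherian A -> is_ideal J0 ->
  F J0 -> exists J, [/\ is_ideal J, F J, J0 `<=` J &
    forall L, is_ideal L -> F L -> J `<=` L -> L `<=` J].
Proof.
move=> An J0i FJ0; apply: contrapT => nomax.
pose T := {J : set A | [/\ is_ideal J, F J & J0 `<=` J]}.
have step (t : T) : {u : T | sval t `<=` sval u /\ ~ sval u `<=` sval t}.
  case: t => J [Ji FJ J0J]; apply: cid; apply: contrapT => noL; apply: nomax.
  exists J; split=> // L Li FL JL; apply: contrapT => LJ; apply: noL.
  by exists (exist _ L (And3 Li FL (subset_trans J0J JL))).
pose t0 : T := exist _ J0 (And3 J0i FJ0 (@subset_refl _ J0)).
pose c n : T := iter n (fun t => sval (step t)) t0.
have cS n : sval (c n) `<=` sval (c n.+1) /\ ~ sval (c n.+1) `<=` sval (c n).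
  exact: (svalP (step (c n))).
have [n ncst] := noetherian_acc (c := fun n => sval (c n)) An
  (fun n => let: And3 h _ _ := svalP (c n) in h) (fun n => (cS n).1).
by have [_] := cS n; apply; exact: ncst.
Qed.

(** An ideal maximal among those that contain [J] and miss the multiplicative set [S] is prime. *)
Lemma prime_avoiding S J : noetherian A -> is_ideal J -> S 1 ->
  (forall x y, S x -> S y -> S (x * y)) -> (forall x, S x -> ~ J x) ->
  exists P, [/\ is_prime P, J `<=` P & forall x, S x -> ~ P x].
Proof.
move=> An Ji S1 SM SJ.
have [P [Pi SP JP Pmax]] :=
  noetherian_max (F := fun L => forall x, S x -> ~ L x) An Ji SJ.
exists P; split=> //; split=> //; first exact: SP.
move=> a b Pab; apply: contrapT => /not_orP[Pa Pb].
have ex x : ~ P x -> exists2 s, S s & principal_ext P x s.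
  move=> Px; apply: contrapT => noS; apply: Px.
  apply: (Pmax (principal_ext P x)); [exact: principal_ext_ideal | |
    exact: principal_ext_sub | exact: principal_ext_mem].
  by move=> s Ss Ps; apply: noS; exists s.
have [s Ss [p [c [Pp sE]]]] := ex a Pa; rewrite sE in Ss.
have [t St [q [d [Pq tE]]]] := ex b Pb; rewrite tE in St.
apply: (SP _ (SM _ _ Ss St)).
have -> : (p + a * c) * (q + b * d) = p * (q + b * d) + a * c * q + a * b * (c * d)
  by ring.
apply: ideal_add => //; last exact: ideal_mulr.
by apply: ideal_add => //; [exact: ideal_mulr | exact: ideal_mull].
Qed.

Lemma radicalP J x : noetherian A -> is_ideal J ->
  (forall P, is_prime P -> J `<=` P -> P x) -> exists n, J (x ^+ n).
Proof.
move=> An Ji Jx; apply: contrapT => noX.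
have [|||P [Pp JP SP]] := prime_avoiding (S := [set x ^+ n | n in setT]) An Ji.
- by exists 0%N => //; rewrite expr0.
- by move=> _ _ [m _ <-] [n _ <-]; exists (m + n)%N => //; rewrite exprD.
- by move=> _ [n _ <-] Jn; apply: noX; exists n.
by apply: (SP (x ^+ 1)); [exists 1%N | rewrite expr1; exact: Jx].
Qed.

Lemma ideal_exp_ideal I n : is_ideal (ideal_exp I n).
Proof. by case: n => [|n]; [exact: ideal_setT | exact: ideal_span_ideal]. Qed.

Lemma ideal_expD I m n x : ideal_exp I (m + n) x ->
  ideal_mul (ideal_exp I m) (ideal_exp I n) x.
Proof.
elim: m x => [|m IH] x.
  by move=> nx; apply: sub_ideal_span; exists 1, x; rewrite mul1r.
apply: ideal_span_sub; first exact: ideal_span_ideal.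
move=> _ [a [y [Ia /IH my ->]]].
have := ideal_span_sub
  (J := colon (ideal_mul (ideal_exp I m.+1) (ideal_exp I n)) a) _ _ my.
rewrite /colon /= mulrC; apply; first exact/colon_ideal/ideal_span_ideal.
move=> _ [u [v [mu nv ->]]]; apply: sub_ideal_span.
exists (a * u), v; split=> //; last by ring.
by apply: sub_ideal_span; exists a, u.
Qed.

(** An ideal maximal among those that contain [J] but no power of [I] would be prime, hence would
    contain [I] and with it the first power. *)
Lemma ideal_exp_sub I J : noetherian A -> is_ideal J ->
  (forall P, is_prime P -> J `<=` P -> I `<=` P) ->
  exists n, ideal_exp I n `<=` J.
Proof.
move=> An Ji IJ; apply: contrapT => noX.
have [|P [Pi FP JP Pmax]] := noetherian_max
  (F := fun L => forall n, ~ ideal_exp I n `<=` L) An Ji.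
  by move=> n nJ; apply: noX; exists n.
have ex x : ~ P x -> exists n, ideal_exp I n `<=` principal_ext P x.
  move=> Px; apply: contrapT => noS; apply: Px.
  apply: (Pmax (principal_ext P x)); [exact: principal_ext_ideal | |
    exact: principal_ext_sub | exact: principal_ext_mem].
  by move=> n nP; apply: noS; exists n.
have Pp : is_prime P.
  split=> //; first by move=> P1; apply: (FP 0%N) => x _; rewrite (ideal_eqT Pi P1).
  move=> a b Pab; apply: contrapT => /not_orP[/ex[m mP] /ex[n nP]].
  apply: (FP (m + n)%N) => x /ideal_expD; apply: ideal_span_sub => //.
  move=> _ [_ [_ [/mP[p [c [Pp ->]]] /nP[q [d [Pq ->]]] ->]]].
  have -> : (p + a * c) * (q + b * d) = p * (q + b * d) + a * c * q + a * b * (c * d)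
    by ring.
  apply: ideal_add => //; last exact: ideal_mulr.
  by apply: ideal_add => //; [exact: ideal_mulr | exact: ideal_mull].
apply: (FP 1%N); apply: ideal_span_sub => // _ [a [b [Ia _ ->]]].
by apply: ideal_mulr => //; exact: IJ Ia.
Qed.

(** * Associated primes and prime avoidance *)

Lemma colon_max J x0 : noetherian A -> is_ideal J -> ~ J x0 ->
  exists x, [/\ ~ J x, colon J x0 `<=` colon J x &
    forall y, ~ J y -> colon J x `<=` colon J y -> colon J y `<=` colon J x].
Proof.
move=> An Ji Jx0.
have [|_ [_ [x Jx ->] x0x xmax]] := noetherian_max
  (F := fun L => exists2 x, ~ J x & L = colon J x) An (colon_ideal x0 Ji).
  by exists x0.
exists x; split=> // y Jy; apply: xmax; first exact: colon_ideal.
by exists y.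
Qed.

Lemma colon_max_prime J x : is_ideal J -> ~ J x ->
  (forall y, ~ J y -> colon J x `<=` colon J y -> colon J y `<=` colon J x) ->
  is_prime (colon J x).
Proof.
move=> Ji Jx xmax; split; [exact: colon_ideal | by rewrite /colon /= mul1r |].
move=> a b; rewrite /colon /= => Jab.
have [Jax|Jax] := pselect (J (a * x)); first by left.
right; apply: (xmax (a * x)) => //.
  by move=> c cx; rewrite /colon /= mulrCA; exact: ideal_mull.
by rewrite /colon /= mulrA (mulrC b).
Qed.

Lemma prime_prod (T : eqType) (P : set A) (ts : seq T) (F : T -> A) :
  is_prime P -> (forall t, t \in ts -> ~ P (F t)) -> ~ P (\prod_(t <- ts) F t).
Proof.
move=> Pp PF; rewrite big_seq; apply: (big_ind (fun x => ~ P x)) => //.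
  by case: Pp.
by move=> x y; exact: primeNM.
Qed.

(** Among the elements with maximal annihilator modulo [J], take finitely many [xs] whose span is
    maximal; it contains all such elements. If no [colon J z] with [z] in [xs] lay in [colon J x],
    choose for each [z] an element that kills it but not [x]: the product kills the span, hence [x],
    against primality of [colon J x]. *)
Lemma finite_associated J : noetherian A -> is_ideal J ->
  exists xs : seq A, (forall x, x \in xs -> ~ J x /\ is_prime (colon J x)) /\
    forall y, ~ J y -> exists2 x, x \in xs & colon J y `<=` colon J x.
Proof.
move=> An Ji.
pose X := [set x | ~ J x /\
  forall y, ~ J y -> colon J x `<=` colon J y -> colon J y `<=` colon J x].
have [|_ [_ [xs xsX ->] _ smax]] := noetherian_max (F := fun L =>
  exists2 s : seq A, [set` s] `<=` X & L = ideal_span [set` s])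
  An (ideal_span_ideal [set` [::]]).
  by exists [::] => // x.
exists xs; split=> [x /xsX[Jx xmax]|y Jy]; first by split=> //; exact: colon_max_prime.
have [x [Jx yx xmax]] := colon_max An Ji Jy.
have xsx : ideal_span [set` xs] x.
  apply: (smax (ideal_span [set` x :: xs])); first exact: ideal_span_ideal.
  - exists (x :: xs) => // z /=; rewrite in_cons => /orP[/eqP->//|/xsX//].
  - apply: ideal_span_sub; first exact: ideal_span_ideal.
    move=> z zs; apply: sub_ideal_span; rewrite /= in_cons; apply/orP; right.
    exact: zs.
  - by apply: sub_ideal_span; rewrite /= mem_head.
have xp := colon_max_prime Ji Jx xmax.
suff [z zs zx] : exists2 z, z \in xs & colon J z `<=` colon J x.
  exists z => //; apply: subset_trans yx _.
  by have [Jz zmax] := xsX z zs; exact: zmax.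
apply: contrapT => noz.
have az z : {a | z \in xs -> colon J z a /\ ~ colon J x a}.
  apply: cid; have [zs|zs] := boolP (z \in xs); last by exists 0.
  apply: contrapT => noa; apply: noz; exists z => // a za.
  by apply: contrapT => xa; apply: noa; exists a.
apply: (prime_prod (ts := xs) (F := fun z => sval (az z)) xp).
  by move=> z zs; have [] := svalP (az z) zs.
set a := \prod_(z <- xs) _.
have := ideal_span_sub (colon_ideal a Ji) _ xsx; rewrite /colon /= mulrC; apply.
move=> z zs; rewrite /colon /= /a (big_rem z) //= mulrA.
apply: ideal_mulr => //; rewrite mulrC.
by have [] := svalP (az z) zs.
Qed.

Lemma prime_avoidance (T : eqType) I (P : T -> set A) (ts : seq T) :
  is_ideal I -> (forall t, t \in ts -> is_prime (P t)) ->
  (forall t, t \in ts -> exists2 h, I h & ~ P t h) ->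
  exists2 h, I h & forall t, t \in ts -> ~ P t h.
Proof.
move=> Ii; elim: ts => [|t ts IH] Pp Pn; first by exists 0 => //; case: Ii.
have [||h Ih hP] := IH.
- by move=> u uts; apply: Pp; rewrite in_cons uts orbT.
- by move=> u uts; apply: Pn; rewrite in_cons uts orbT.
have tp : is_prime (P t) by apply: Pp; rewrite mem_head.
have [Pth|Pth] := pselect (P t h); last first.
  by exists h => // u; rewrite in_cons => /orP[/eqP->//|]; exact: hP.
have [b Ib Ptb] : exists2 b, I b & ~ P t b by apply: Pn; rewrite mem_head.
(* No factor of [c] lies in [P t], and the factor for [u] lies in [P u] unless [P u] is contained in
   [P t]. So [h + b * c] avoids [P t], thereby every [P u] inside [P t], and is congruent to [h]
   modulo the other [P u]. *)
have cu u : {c | ~ P t c /\ (P u c \/ P u `<=` P t)}.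
  apply: cid; have [?|/existsNP[c /not_implyP[uc tc]]] := pselect (P u `<=` P t).
    by exists 1; split; [case: tp | right].
  by exists c; split=> //; left.
pose c := \prod_(u <- ts) sval (cu u).
have Ptc : ~ P t c by apply: prime_prod => // u _; have [] := svalP (cu u).
have Pth' : ~ P t (h + b * c).
  move=> Phbc; apply: (primeNM tp Ptb Ptc).
  rewrite -[b * c](addKr h) addrC; apply: ideal_sub => //; by case: tp.
exists (h + b * c); first by apply: ideal_add => //; exact: ideal_mulr.
move=> u; rewrite in_cons => /orP[/eqP->//|uts].
have [_ [uc|uPt]] := svalP (cu u); last by move=> /uPt.
have ui : is_ideal (P u) by have [] : is_prime (P u) by apply: Pp; rewrite in_cons uts orbT.
move=> uhbc; apply: (hP u uts).
rewrite -[h](addrK (b * c)); apply: ideal_sub => //.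
by rewrite /c (big_rem u) //= mulrCA; apply: ideal_mulr.
Qed.

(** The zero divisors modulo [J] lie in finitely many associated primes, none of which contains [I].
    With [J] = 0 this yields f, with [J] = fB :&: A it yields g. *)
Lemma regular_element I J : noetherian A -> is_ideal I -> is_ideal J ->
  (forall x, (forall a, I a -> J (a * x)) -> J x) ->
  exists2 h, I h & forall x, J (h * x) -> J x.
Proof.
move=> An Ii Ji IJ; have [xs [xsp xsmax]] := finite_associated An Ji.
have [||h Ih hxs] := prime_avoidance (P := colon J) (ts := xs) Ii.
- by move=> x /xsp[].
- move=> x /xsp[Jx _]; apply: contrapT => noh; apply: Jx; apply: IJ => a Ia.
  by apply: contrapT => Jax; apply: noh; exists a.
exists h => // y Jhy; apply: contrapT => Jy.
by have [x xxs yx] := xsmax y Jy; apply: (hxs x xxs); exact: yx.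
Qed.

(** * Noetherian local rings *)

Section Local.
Variable m : set A.
Hypotheses (An : noetherian A) (Am : local_with m).

Lemma local_ideal : is_ideal m. Proof. by case: Am => -[]. Qed.
Lemma local_proper : ~ m 1. Proof. by case: Am => -[]. Qed.

Lemma local_sub J : is_ideal J -> ~ J 1 -> J `<=` m.
Proof.
move=> Ji J1; have [L [Li L1 JL Lmax]] :=
  noetherian_max (F := fun L => ~ L 1) An Ji J1.
case: Am => _ /(_ L) <- //; split=> // K Ki K1 LK.
by apply/seteqP; split=> //; exact: Lmax.
Qed.

Lemma local_unit x : ~ m x -> exists y, y * x = 1.
Proof.
move=> mx; apply: contrapT => nou; apply: mx.
apply: (local_sub (principal_ext_ideal x (J := [set 0]) _)).
- split=> //= [_ _ -> ->|a _ ->]; by rewrite ?addr0 ?mulr0.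
- move=> [p [c [/= ->]]]; rewrite add0r => e; apply: nou; exists c.
  by rewrite mulrC.
- by exists 0, 1; split=> //; rewrite add0r mulr1.
Qed.

Lemma local_prime : is_prime m.
Proof.
split; [exact: local_ideal | exact: local_proper |].
move=> a b mab; apply: contrapT => /not_orP[/local_unit[u ua] /local_unit[v vb]].
apply: local_proper; rewrite -[1]mulr1 -{1}ua -vb.
rewrite [_ * _](_ : _ = u * v * (a * b)); last by ring.
by apply: ideal_mull => //; exact: local_ideal.
Qed.

(* A maximal counterexample J is enlarged by a socle element x of A/J. *)
Lemma local_dcc K (c : nat -> set A) : is_ideal K ->
  (forall P, is_prime P -> K `<=` P -> P = m) ->
  (forall n, is_ideal (c n)) -> (forall n, K `<=` c n) ->
  (forall n, c n.+1 `<=` c n) ->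
  exists n, forall k, (n <= k)%N -> c k `<=` c k.+1.
Proof.
move=> Ki Km ci Kc cS; apply: contrapT => noc.
have [|J [Ji [c' [{}ci Jc {}cS {}noc]] KJ Jmax]] := noetherian_max (F := fun L =>
    exists c : nat -> set A, [/\ forall n, is_ideal (c n), forall n, L `<=` c n,
    forall n, c n.+1 `<=` c n &
    ~ exists n, forall k, (n <= k)%N -> c k `<=` c k.+1]) An Ki.
  by exists c.
move: c' ci Jc cS noc => {Kc} {}c ci Jc cS noc.
have J1 : ~ J 1.
  by move=> J1; apply: noc; exists 0%N => k _ x _; apply: Jc; rewrite (ideal_eqT Ji J1).
have [x [Jx _ xmax]] := colon_max An Ji J1.
have xm : colon J x = m.
  apply: Km; first exact: colon_max_prime.
  by apply: subset_trans KJ _; exact: sub_colon.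
have mJ a : m a -> J (x * a) by rewrite -xm /colon /= mulrC.
have cE k n : (k <= n)%N -> c n `<=` c k.
  elim: n => [|n IH]; first by rewrite leqn0 => /eqP->.
  rewrite leq_eqVlt ltnS => /orP[/eqP->//|/IH]; exact: subset_trans.
have Jxi := principal_ext_ideal x Ji.
have stabx (d : nat -> set A) : (forall n, is_ideal (d n)) ->
    (forall n, principal_ext J x `<=` d n) -> (forall n, d n.+1 `<=` d n) ->
    exists n, forall k, (n <= k)%N -> d k `<=` d k.+1.
  move=> di Jd dS; apply: contrapT => nod; apply: Jx.
  apply: (Jmax (principal_ext J x)); [exact: Jxi | |
    exact: principal_ext_sub | exact: principal_ext_mem].
  by exists d.
(* If all [c n] contain [x], the chain lies over J + xA and is stationary by maximality. Otherwise
   the chain of the [c n] + xA is stationary, and this descends: in y = z + x a, a unit [a] would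
   put [x] in [c k], and for [a] in [m] the term x a is in [J]. *)
have [cx|/existsNP[n1 cn1]] := pselect (forall n, c n x).
  apply: noc; apply: stabx => // n _ [p [a [Jp ->]]].
  by apply: ideal_add => //; [exact: Jc | exact: ideal_mulr].
have [||| n0 n0P] := stabx (fun n => principal_ext (c n) x).
- by move=> n; exact: principal_ext_ideal.
- by move=> n _ [p [a [Jp ->]]]; exists p, a; split=> //; exact: Jc.
- by move=> n _ [p [a [cp ->]]]; exists p, a; split=> //; exact: cS.
apply: noc; exists (maxn n0 n1) => k; rewrite geq_max => /andP[n0k n1k] y cy.
have [z [a [cz yE]]] := n0P k n0k y (principal_ext_sub x cy).
have cxa : c k (x * a).
  have -> : x * a = y - z by rewrite yE; ring.
  by apply: ideal_sub => //; exact: cS.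
have [ma|/local_unit[u ua]] := pselect (m a).
  by rewrite yE; apply: ideal_add => //; apply: Jc; exact: mJ.
exfalso; apply: cn1; apply: (cE n1 k) => //.
have -> : x = x * a * u by rewrite -mulrA (mulrC a) ua mulr1.
exact: ideal_mulr.
Qed.

End Local.
End IdealTheory.

(** * Finite modules, Hilbert's basis theorem, Krull's intersection theorem *)

Lemma ideal_span_seqP (A : comPzRingType) (s : seq A) x :
  ideal_span [set` s] x -> exists c : 'I_(size s) -> A, x = \sum_i c i * s`_i.
Proof.
have := @ideal_span_sub _ [set` s]
  [set x | exists c : 'I_(size s) -> A, x = \sum_i c i * s`_i].
apply; last first.
  move=> y /= ys; have ylt : (index y s < size s)%N by rewrite index_mem.
  exists (fun i => (i == Ordinal ylt)%:R).
  rewrite (bigD1 (Ordinal ylt)) //= eqxx mul1r nth_index // big1 ?addr0 //.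
  by move=> i /negbTE->; rewrite mul0r.
split.
- by exists (fun=> 0); rewrite big1 // => i _; rewrite mul0r.
- move=> _ _ [c ->] [d ->]; exists (fun i => c i + d i).
  by rewrite -big_split; apply: eq_bigr => i _; rewrite mulrDl.
- move=> a _ [c ->]; exists (fun i => a * c i).
  by rewrite mulr_sumr; apply: eq_bigr => i _; rewrite mulrA.
Qed.

Section DeterminantTrick.
Variables (A B : comPzRingType) (phi : {rmorphism A -> B}).

Lemma det_congr (J : set A) n (M N : 'M[A]_n) : is_ideal J ->
  (forall i j, J (M i j - N i j)) -> J (\det M - \det N).
Proof.
move=> Ji MN.
have congD (x y z t : A) : J (x - y) -> J (z - t) -> J (x + z - (y + t)).
  by move=> xy zt; rewrite opprD addrACA; exact: ideal_add.
have congM (x y z t : A) : J (x - y) -> J (z - t) -> J (x * z - y * t).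
  move=> xy zt; rewrite (_ : _ - _ = z * (x - y) + y * (z - t)); last by ring.
  by apply: ideal_add => //; exact: ideal_mull.
have J0 (x : A) : J (x - x) by rewrite subrr; case: Ji.
apply: (big_ind2 (fun x y => J (x - y))); [exact: J0 | |].
  by move=> *; exact: congD.
move=> s _; apply: (congM); first exact: J0.
by apply: (big_ind2 (fun x y => J (x - y))); [exact: J0 | move=> *; exact: congM |].
Qed.

(** The adjugate of x - c turns the relations modulo [L] into one for the determinant. With [L] = 0
    this is Cayley-Hamilton; with [x] = 1, [J] = m and [L] = N + dB it is Nakayama's lemma. *)
Lemma det_trick (J : set A) (L : set B) n (e : 'I_n -> B) x : is_ideal J ->
  L 0 -> (forall y z, L y -> L z -> L (y + z)) ->
  (forall a y, L y -> L (phi a * y)) ->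
  (forall i, exists c : 'I_n -> A, (forall j, J (c j)) /\
     L (phi x * e i - \sum_j phi (c j) * e j)) ->
  exists d, J (d - x ^+ n) /\ forall i, L (phi d * e i).
Proof.
move=> Ji L0 LD LM /choice[c cP].
pose M : 'M[A]_n := x%:M - \matrix_(i, j) c i j.
exists (\det M); split.
  rewrite -(det_scalar n x); apply: det_congr => // i j.
  rewrite !mxE addrAC subrr add0r; apply: ideal_opp => //.
  by have [] := cP i.
have LMe i : L (\sum_j phi (M i j) * e j).
  have [_] := cP i; congr L; symmetry.
  rewrite (eq_bigr (fun j => phi (x%:M i j) * e j - phi (c i j) * e j)); last first.
    by move=> j _; rewrite !mxE rmorphB mulrBl.
  rewrite sumrB (bigD1 i) //= mxE eqxx big1 ?addr0 // => j /negbTE ji.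
  by rewrite mxE eq_sym ji rmorph0 mul0r.
move=> k; have : L (\sum_i phi (\adj M k i) * \sum_j phi (M i j) * e j).
  by apply: big_ind => // i _; exact: LM.
congr L; under eq_bigr do rewrite mulr_sumr.
rewrite exchange_big /=.
rewrite (eq_bigr (fun j => phi ((\adj M *m M) k j) * e j)); last first.
  move=> j _; rewrite mxE rmorph_sum mulr_suml; apply: eq_bigr => i _.
  by rewrite rmorphM mulrA.
rewrite mul_adj_mx (bigD1 k) //= mxE eqxx big1 ?addr0 // => j /negbTE jk.
by rewrite mxE eq_sym jk rmorph0 mul0r.
Qed.

End DeterminantTrick.

(** * Ascending chains and the adjunction of generators *)

Section HilbertBasis.
Variable B : comPzRingType.
Implicit Types (S L : set B) (b : B).

(** Subrings of B and their ideals are sets in B, so that generators can be adjoined one at a time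
    inside B, without polynomial rings. *)
Definition subring_set S :=
  [/\ S 1, forall x y, S x -> S y -> S (x - y) &
      forall x y, S x -> S y -> S (x * y)].

Definition ideal_of S L :=
  [/\ L `<=` S, L 0, forall x y, L x -> L y -> L (x + y) &
      forall s x, S s -> L x -> L (s * x)].

Definition acc_on S := forall c : nat -> set B, (forall n, ideal_of S (c n)) ->
  (forall n, c n `<=` c n.+1) -> exists n, forall k, (n <= k)%N -> c k `<=` c n.

Definition poly_lt S b n : set B :=
  [set x | exists s : nat -> B, (forall i, S (s i)) /\ x = \sum_(i < n) s i * b ^+ i].

Definition adjoin S b : set B := \bigcup_n poly_lt S b n.

Section Adjoin.
Variables (S : set B) (b : B).
Hypothesis Sr : subring_set S.

Let S0 : S 0. Proof. by case: Sr => S1 SB _; rewrite -(subrr 1); exact: SB. Qed.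
Let S1 : S 1. Proof. by case: Sr. Qed.
Let SB x y : S x -> S y -> S (x - y). Proof. by case: Sr => _ + _; apply. Qed.
Let SM x y : S x -> S y -> S (x * y). Proof. by case: Sr => _ _; apply. Qed.
Let SN x : S x -> S (- x). Proof. by move=> Sx; rewrite -sub0r; exact: SB. Qed.
Let SD x y : S x -> S y -> S (x + y).
Proof. by move=> Sx Sy; rewrite -[y]opprK; apply: SB => //; exact: SN. Qed.

Lemma poly_lt0 n : poly_lt S b n 0.
Proof. by exists (fun=> 0); split=> //; rewrite big1 // => i _; rewrite mul0r. Qed.

Lemma poly_ltD n x y : poly_lt S b n x -> poly_lt S b n y -> poly_lt S b n (x + y).
Proof.
move=> [s [Ss ->]] [t [St ->]]; exists (fun i => s i + t i); split.
  by move=> i; exact: SD.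
by rewrite -big_split; apply: eq_bigr => i _; rewrite mulrDl.
Qed.

Lemma poly_ltM n t x : S t -> poly_lt S b n x -> poly_lt S b n (t * x).
Proof.
move=> St [s [Ss ->]]; exists (fun i => t * s i); split.
  by move=> i; exact: SM.
by rewrite mulr_sumr; apply: eq_bigr => i _; rewrite mulrA.
Qed.

Lemma poly_ltB n x y : poly_lt S b n x -> poly_lt S b n y -> poly_lt S b n (x - y).
Proof.
move=> nx ny; apply: poly_ltD => //; rewrite -mulN1r; apply: poly_ltM => //.
exact: SN.
Qed.

Lemma poly_lt_shift n x : poly_lt S b n x -> poly_lt S b n.+1 (b * x).
Proof.
move=> [s [Ss ->]]; exists (fun i => if i is j.+1 then s j else 0); split.
  by case.
rewrite big_ord_recl mul0r add0r mulr_sumr; apply: eq_bigr => i _.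
by rewrite /= exprS mulrCA.
Qed.

Lemma poly_ltS n x : poly_lt S b n.+1 x <->
  exists s u, [/\ S s, poly_lt S b n u & x = s * b ^+ n + u].
Proof.
split=> [[s [Ss ->]]|[s [_ [Ss [t [St ->]] ->]]]].
  exists (s n), (\sum_(i < n) s i * b ^+ i); split=> //; first by exists s.
  by rewrite big_ord_recr addrC.
exists (fun i => if (i < n)%N then t i else s); split; first by move=> i; case: ifP.
rewrite big_ord_recr /= ltnn addrC; congr (_ + _).
by apply: eq_bigr => i _; rewrite ltn_ord.
Qed.

Lemma poly_lt_le m n x : (m <= n)%N -> poly_lt S b m x -> poly_lt S b n x.
Proof.
elim: n => [|n IH]; first by rewrite leqn0 => /eqP->.
rewrite leq_eqVlt ltnS => /orP[/eqP->//|/IH{}IH /IH nx].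
by apply/poly_ltS; exists 0, x; split=> //; rewrite mul0r add0r.
Qed.

Lemma sub_adjoin : S `<=` adjoin S b.
Proof.
move=> x Sx; exists 1%N => //; apply/poly_ltS; exists x, 0.
by split=> //; [exact: poly_lt0 | rewrite expr0 mulr1 addr0].
Qed.

Lemma mem_adjoin : adjoin S b b.
Proof.
by exists 2%N => //; rewrite -[X in poly_lt _ _ _ X]mulr1; apply: poly_lt_shift;
  apply/poly_ltS; exists 1, 0; split=> //; [exact: poly_lt0 | rewrite mulr1 addr0].
Qed.

Lemma adjoin_subring : subring_set (adjoin S b).
Proof.
split; first exact: sub_adjoin.
  move=> x y [m _ mx] [n _ ny]; exists (maxn m n) => //.
  by apply: poly_ltB; apply: poly_lt_le; [exact: leq_maxl | | exact: leq_maxr |].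
move=> x y [m _ mx] [n _ ny]; exists (m + n)%N => //; elim: m x mx => [|m IH] x.
  by move=> [s [_ ->]]; rewrite big_ord0 mul0r; exact: poly_lt0.
move=> /poly_ltS[s [u [Ss um ->]]]; rewrite mulrDl; apply: poly_ltD; last first.
  by rewrite addSn; apply: poly_lt_le (IH _ um).
rewrite -mulrA; apply: poly_ltM => //.
apply: (poly_lt_le (leqnSn (m + n))); rewrite addnC.
elim: m {IH u um} => [|m IH]; first by rewrite addn0 expr0 mul1r.
by rewrite exprS -mulrA addnS; exact: poly_lt_shift.
Qed.

(* Ideals of leading coefficients: a chain of ideals of S[b] is bounded as soon
   as the doubly indexed family of its leading coefficient ideals is. *)
Lemma acc_adjoin : acc_on S -> acc_on (adjoin S b).
Proof.
move=> Sacc c ci cS.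
have cle := ascending_le cS.
have c0 k : c k 0 by case: (ci k).
have cD k x y : c k x -> c k y -> c k (x + y) by case: (ci k) => _ _ + _; apply.
have cM k s x : adjoin S b s -> c k x -> c k (s * x) by case: (ci k) => _ _ _; apply.
have cB k x y : c k x -> c k y -> c k (x - y).
  move=> kx ky; apply: cD => //; rewrite -mulN1r; apply: cM => //.
  by apply: sub_adjoin; exact: SN.
(* Expressions in powers of [b] are not unique: [s] counts as a leading coefficient as soon as one
   expression of an element of [c k] has it. *)
pose lead k n := [set s | S s /\ exists2 u, poly_lt S b n u & c k (s * b ^+ n + u)].
have leadi k n : ideal_of S (lead k n).
  split; first by move=> s [].
  - by split=> //; exists 0; [exact: poly_lt0 | rewrite mul0r addr0].
  - move=> s t [Ss [u un su]] [St [v vn tv]]; split; first exact: SD.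
    exists (u + v); first exact: poly_ltD.
    by rewrite mulrDl addrACA; exact: cD.
  - move=> t s St [Ss [u un su]]; split; first exact: SM.
    exists (t * u); first exact: poly_ltM.
    by rewrite -mulrA -mulrDr; apply: cM => //; exact: sub_adjoin.
have lead1 i j n : (i <= j)%N -> lead i n `<=` lead j n.
  by move=> ij s [Ss [u un su]]; split=> //; exists u => //; exact: cle su.
have lead2 k i j : (i <= j)%N -> lead k i `<=` lead k j.
  elim: j => [|j IH]; first by rewrite leqn0 => /eqP->.
  rewrite leq_eqVlt ltnS => /orP[/eqP->//|/IH h s /h[Ss [u un su]]].
  split=> //; exists (b * u); first exact: poly_lt_shift.
  by rewrite exprS mulrCA -mulrDr; apply: cM => //; exact: mem_adjoin.
(* The diagonal chain bounds [lead k n] for [k] and [n] at least [K0]; the finitely many columns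
   with [n < K0] are bounded one by one. *)
have [K0 K0P] : exists K, forall k, (K <= k)%N -> lead k k `<=` lead K K.
  apply: (Sacc (fun k => lead k k)) => [k|k]; first exact: leadi.
  by apply: subset_trans (lead1 k k.+1 k _) (lead2 _ _ _ _).
have [K1 K1P] : exists K, forall n, (n < K0)%N -> forall k, (K <= k)%N ->
    lead k n `<=` lead K n.
  elim: K0 {K0P} => [|N [K KP]]; first by exists 0%N.
  have [K' K'P] := Sacc (fun k => lead k N) (fun k => leadi k N)
    (fun k => lead1 _ _ N (leqnSn k)).
  exists (maxn K K') => n; rewrite ltnS leq_eqVlt => /orP[/eqP->|nN] k.
    rewrite geq_max => /andP[_ /K'P/subset_trans]; apply; apply: lead1.
    exact: leq_maxr.
  rewrite geq_max => /andP[/(KP _ nN)/subset_trans + _]; apply; apply: lead1.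
  exact: leq_maxl.
pose K := maxn K0 K1.
have KP n k : (K <= k)%N -> lead k n `<=` lead K n.
  rewrite geq_max => /andP[K0k K1k]; have [nK0|K0n] := ltnP n K0.
    by apply: subset_trans (K1P _ nK0 _ K1k) _; apply: lead1; exact: leq_maxr.
  apply: (@subset_trans _ (lead K0 K0)); last first.
    by apply: subset_trans (lead2 _ _ _ K0n); apply: lead1; exact: leq_maxl.
  apply: subset_trans (K0P (maxn k n) _); last by rewrite leq_max K0k.
  by apply: subset_trans (lead1 _ _ _ (leq_maxl k n)) (lead2 _ _ _ (leq_maxr k n)).
exists K => k Kk x kx.
have [n _ nx] : adjoin S b x by case: (ci k) => + _ _ _; apply.
elim: n x kx nx => [|n IH] x kx.
  by move=> [s [_ ->]]; rewrite big_ord0.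
move=> /poly_ltS[s [u [Ss un xE]]].
have [|_ [v vn sv]] := KP n k Kk s; first by split=> //; exists u; rewrite -?xE.
rewrite -[x](subrK (s * b ^+ n + v)); apply: cD => //; apply: IH.
  by apply: cB => //; exact: cle sv.
by rewrite xE opprD addrACA subrr add0r; exact: poly_ltB.
Qed.

End Adjoin.

Lemma acc_noetherian : acc_on setT -> noetherian B.
Proof.
move=> Bacc J Ji; apply: contrapT => nofg.
have [J0 _ _] := Ji.
pose T := {s : seq B | [set` s] `<=` J}.
have step (t : T) : {u : T | ideal_span [set` sval t] `<=` ideal_span [set` sval u] /\
    ~ ideal_span [set` sval u] `<=` ideal_span [set` sval t]}.
  case: t => s sJ; apply: cid; apply: contrapT => noL; apply: nofg; exists s.
  apply/seteqP; split; last exact: ideal_span_sub.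
  move=> x Jx; apply: contrapT => sx; apply: noL.
  have xsJ : [set` x :: s] `<=` J.
    by move=> y /=; rewrite in_cons => /orP[/eqP->//|/sJ].
  exists (exist (fun s : seq B => [set` s] `<=` J) (x :: s) xsJ); split=> /=.
    apply: ideal_span_sub; first exact: ideal_span_ideal.
    by move=> y ys; apply: sub_ideal_span; rewrite /= in_cons; apply/orP; right.
  by move=> /(_ x)H; apply: sx; apply: H; apply: sub_ideal_span; rewrite /= mem_head.
have nilJ : [set` [::]] `<=` J by move=> x.
pose c n : T := iter n (fun t => sval (step t)) (exist (fun s : seq B => [set` s] `<=` J) [::] nilJ).
have [n|n|n nP] := Bacc (fun n => ideal_span [set` sval (c n)]).
- by have [? ? ?] := ideal_span_ideal [set` sval (c n)]; split=> // a x _; auto.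
- by have [] := svalP (step (c n)).
- by have [_] := svalP (step (c n)); apply; exact: (nP n.+1).
Qed.

End HilbertBasis.

(** The generators are adjoined successively to the image of A, whose ideals pull back to ideals of
    A. *)
Lemma finite_type_noetherian (A B : comPzRingType) (phi : {rmorphism A -> B}) :
  noetherian A -> finite_type phi -> noetherian B.
Proof.
move=> An [gens gensP]; apply: acc_noetherian.
have [S [Sr Sacc Sphi Sgens]] : exists S : set B, [/\ subring_set S, acc_on S,
    forall a, S (phi a) & {subset gens <= S}].
  elim: gens {gensP} => [|b gens [S [Sr Sacc Sphi Sgens]]].
    exists (range phi); split=> //.
    - split; first by exists 1; rewrite ?rmorph1.
        by move=> _ _ [x _ <-] [y _ <-]; exists (x - y); rewrite ?rmorphB.
      by move=> _ _ [x _ <-] [y _ <-]; exists (x * y); rewrite ?rmorphM.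
    - move=> c ci cS.
      have [n|n|n nP] := noetherian_acc (c := fun n => phi @^-1` c n) An.
      + case: (ci n) => _ c0 cD cM; split; rewrite /preimage /=.
        * by rewrite rmorph0.
        * by move=> x y cx cy; rewrite rmorphD; exact: cD.
        * by move=> a x cx; rewrite rmorphM; apply: cM => //; exists a.
      + by move=> x; exact: cS.
      exists n => k nk x kx; case: (ci k) => /(_ x kx)[a _ ax] _ _ _.
      by rewrite -ax; apply: (nP k nk a); rewrite /preimage /= ax.
  exists (adjoin S b); split.
  - exact: adjoin_subring.
  - exact: acc_adjoin.
  - by move=> a; apply: sub_adjoin.
  - move=> x; rewrite in_cons => /orP[/eqP->|/Sgens xS].
      by apply/mem_set; exact: mem_adjoin.
    by apply/mem_set; apply: sub_adjoin => //; exact: set_mem.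
suff -> : setT = S by [].
apply/seteqP; split=> // x _; apply: set_mem; move: x.
apply: gensP => //; last by move=> a; exact/mem_set.
have [S1 SB SM] := Sr; split; first exact/mem_set.
  by move=> x y /set_mem Sx /set_mem Sy; apply/mem_set; exact: SB.
by move=> x y /set_mem Sx /set_mem Sy; apply/mem_set; exact: SM.
Qed.

(** * Extended ideals and Krull's intersection theorem *)

Section ExtendedIdeal.
Variables (A B : comPzRingType) (phi : {rmorphism A -> B}).
Implicit Types J K : set A.

Definition ext_ideal J : set B := ideal_span (phi @` J).

Lemma ext_ideal_ideal J : is_ideal (ext_ideal J).
Proof. exact: ideal_span_ideal. Qed.

Lemma ext_ideal_mem J a : J a -> ext_ideal J (phi a).
Proof. by move=> Ja; apply: sub_ideal_span; exists a. Qed.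

Lemma ext_ideal_sub J (Q : set B) : is_ideal Q -> (forall a, J a -> Q (phi a)) ->
  ext_ideal J `<=` Q.
Proof. by move=> Qi JQ; apply: ideal_span_sub => // _ [a Ja <-]; exact: JQ. Qed.

Lemma preimage_ideal (Q : set B) : is_ideal Q -> is_ideal (phi @^-1` Q).
Proof.
move=> Qi; split; rewrite /preimage /=.
- by rewrite rmorph0; case: Qi.
- by move=> x y Qx Qy; rewrite rmorphD; exact: ideal_add.
- by move=> a x Qx; rewrite rmorphM; exact: ideal_mull.
Qed.

(* Q is maximal with Q :&: N contained in J N; then Q contains a power of J. *)
Lemma krull_intersection J : noetherian A -> noetherian B -> is_ideal J ->
  exists2 d, ext_ideal J (d - 1) &
    forall x, (forall n, ext_ideal (ideal_exp J n) x) -> d * x = 0.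
Proof.
move=> An Bn Ji; pose N := [set x | forall n, ext_ideal (ideal_exp J n) x].
have Ni : is_ideal N.
  split=> [n|x y Nx Ny n|a x Nx n]; first by case: (ext_ideal_ideal (ideal_exp J n)).
    exact: (ideal_add (ext_ideal_ideal _) (Nx n) (Ny n)).
  exact: (ideal_mull _ (ext_ideal_ideal _) (Nx n)).
pose JN := ideal_span [set z | exists a x, [/\ J a, N x & z = phi a * x]].
have JNi : is_ideal JN by exact: ideal_span_ideal.
have JNmem a x : J a -> N x -> JN (phi a * x).
  by move=> Ja Nx; apply: sub_ideal_span; exists a, x.
have [|Q [Qi QN JNQ Qmax]] := noetherian_max
  (F := fun Q => Q `&` N `<=` JN) Bn JNi; first by move=> x [].
(* Once the colons are stationary, adding [phi a ^+ n] to [Q] creates no new element of N: [phi a]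
   times an element [q + phi a ^+ n * b] of N is in JN, hence in [Q], so [phi a ^+ n * b] was
   already in [Q]. Maximality puts [phi a ^+ n] in [Q]. *)
have JQ a : J a -> exists n, Q (phi a ^+ n).
  move=> Ja.
  have [n|n x|n nP] := noetherian_acc (c := fun n => colon Q (phi a ^+ n)) Bn.
  - exact: colon_ideal.
  - by rewrite /colon /= exprS mulrCA; exact: ideal_mull.
  exists n; apply: (Qmax (principal_ext Q (phi a ^+ n))).
  - exact: principal_ext_ideal.
  - move=> _ [[q [b [Qq ->]]] Ny]; apply: QN; split=> //.
    apply: ideal_add => //; rewrite mulrC; apply: (nP n.+1) => //.
    rewrite /colon /= exprS.
    have -> : b * (phi a * phi a ^+ n) = phi a * (q + phi a ^+ n * b) - phi a * q.
      by ring.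
    by apply: ideal_sub => //; [apply: JNQ; exact: JNmem | exact: ideal_mull].
  - exact: principal_ext_sub.
  - exact: principal_ext_mem.
have [||k kQ] := @ideal_exp_sub _ J (phi @^-1` Q) An.
- exact: preimage_ideal.
- move=> P Pp QP a Ja; have [n nQ] := JQ a Ja.
  by apply: (primeX (n := n)) => //; apply: QP; rewrite /preimage /= rmorphXn.
have NJN : N `<=` JN.
  move=> x Nx; apply: QN; split=> //.
  exact: (ext_ideal_sub Qi kQ (Nx k)).
(* Since N = JN, the determinant trick with [x := 1] on generators of N yields [d]. *)
have [s sE] := Bn N Ni.
have [|||||d [Jd dN]] := det_trick (phi := idfun) (J := ext_ideal J) (L := [set 0])
  (e := fun i : 'I_(size s) => s`_i) (x := 1).
- exact: ext_ideal_ideal.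
- by [].
- by move=> y z /= -> ->; rewrite addr0.
- by move=> a y /= ->; rewrite mulr0.
- move=> i; have : JN s`_i.
    by apply: NJN; rewrite sE; apply: sub_ideal_span; rewrite /= mem_nth.
  have : JN `<=` [set x | exists c : 'I_(size s) -> B,
      (forall j, ext_ideal J (c j)) /\ x = \sum_j c j * s`_j].
    have Ei := ext_ideal_ideal J; apply: ideal_span_sub.
      split.
      + exists (fun=> 0); split; first by case: Ei.
        by rewrite big1 // => j _; rewrite mul0r.
      + move=> _ _ [c [Jc ->]] [c' [Jc' ->]]; exists (fun j => c j + c' j); split.
          by move=> j; exact: (ideal_add Ei).
        by rewrite -big_split; apply: eq_bigr => j _; rewrite mulrDl.
      + move=> b _ [c [Jc ->]]; exists (fun j => b * c j); split.
          by move=> j; exact: (ideal_mull _ Ei).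
        by rewrite mulr_sumr; apply: eq_bigr => j _; rewrite mulrA.
    move=> _ [a [x [Ja + ->]]]; rewrite sE => /ideal_span_seqP[c ->].
    exists (fun j => phi a * c j); split.
      by move=> j; apply: ideal_mulr (ext_ideal_mem Ja).
    by rewrite mulr_sumr; apply: eq_bigr => j _; rewrite mulrA.
  move=> /[apply] -[c [Jc siE]]; exists c; split=> //=.
  by rewrite mul1r -siE subrr.
exists d; first by rewrite expr1n in Jd.
move=> x Nx; have : N x by []; rewrite sE => /ideal_span_seqP[c ->].
rewrite mulr_sumr big1 // => i _; rewrite mulrCA.
by have /= -> := dN i; rewrite mulr0.
Qed.

End ExtendedIdeal.

(** * The unit ideal theorem *)

Section Dimension.
Variable A : comPzRingType.
Implicit Types P Q : set A.

Lemma dim2_chain P0 P1 P2 P3 : has_krull_dim A 2 -> is_prime P0 -> is_prime P1 ->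
  is_prime P2 -> is_prime P3 -> P0 `<` P1 -> P1 `<` P2 -> P2 `<` P3 -> False.
Proof.
move=> [_ dim2] p0 p1 p2 p3 p01 p12 p23.
have := dim2 3%N (fun i => match i with 0 => P0 | 1 => P1 | 2 => P2 | _ => P3 end).
suff c : prime_chain 3 (fun i => match i with 0 => P0 | 1 => P1 | 2 => P2 | _ => P3 end).
  by move=> /(_ c).
by split; [move=> [|[|[|[]]]] | move=> [|[|[]]]].
Qed.

(** Otherwise a prime avoids the multiplicative set of all [s * x ^+ n]. It is contained in [P],
    hence equal to [P] by minimality, although it misses [x]. *)
Lemma minimal_prime_zero_divisor P x : noetherian A -> minimal_prime P -> P x ->
  exists s n, ~ P s /\ s * x ^+ n = 0.
Proof.
move=> An [Pp Pmin] Px; apply: contrapT => noz.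
have [||||Q [Qp _ SQ]] := @prime_avoiding A
  [set y | exists s n, ~ P s /\ y = s * x ^+ n] [set 0] An.
- by split=> //= [_ _ -> ->|a _ ->]; rewrite ?addr0 ?mulr0.
- by exists 1, 0%N; rewrite expr0 mulr1; split=> //; case: Pp.
- move=> _ _ [s [i [Ps ->]]] [t [j [Pt ->]]]; exists (s * t), (i + j)%N.
  by split; [exact: primeNM | rewrite exprD; ring].
- by move=> _ [s [n [Ps ->]]] /= e; apply: noz; exists s, n.
have QP : Q `<=` P.
  move=> y Qy; apply: contrapT => Py; apply: (SQ y) => //.
  by exists y, 0%N; rewrite expr0 mulr1.
apply: (SQ x); last by rewrite (Pmin Q).
by exists 1, 1%N; rewrite expr1 mul1r; split=> //; case: Pp.
Qed.

Lemma regularX (f x : A) n : (forall y, f * y = 0 -> y = 0) ->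
  f ^+ n * x = 0 -> x = 0.
Proof.
by move=> freg; elim: n => [|n IH]; rewrite ?expr0 ?mul1r // exprS -mulrA => /freg.
Qed.

Variable m : set A.
Hypotheses (An : noetherian A) (Am : local_with m) (dim2 : has_krull_dim A 2).

(** The top of a chain of length 2 can be replaced by [m]. *)
Lemma maximal_not_height1 : ~ prime_has_height m 1%N.
Proof.
case: dim2 => -[c [cp cS]] _ [_ /(_ 2%N (fun i => if i is 2 then m else c i))].
move=> H; suff /H/(_ erefl) : prime_chain 2 (fun i => if i is 2 then m else c i) by [].
split.
  by move=> [|[|[|//]]] // _; [exact: (cp 0%N) | exact: (cp 1%N) |
    exact: (local_prime An Am)].
move=> [|[|//]] // _; first exact: (cS 0%N).
have [c12 c21] := cS 1%N isT.
have c2m : c 2%N `<=` m.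
  by have [c2i c2p _] := cp 2%N isT; exact: (local_sub An Am).
split; first exact: subset_trans c12 c2m.
by move=> mc1; apply: c21; exact: subset_trans c2m mc1.
Qed.

Variable f : A.
Hypothesis freg : forall x, f * x = 0 -> x = 0.

(** Otherwise a prime Q over [f] lies strictly inside [P], itself strictly inside [m]. The dimension
    makes Q minimal, so that [f] would be a zero divisor. *)
Lemma prime_minimal_over P x : is_prime P -> P <> m -> P f -> P x ->
  exists s n a, ~ P s /\ s * x ^+ n = f * a.
Proof.
move=> Pp Pm Pf Px; apply: contrapT => noz.
have [||||Q [Qp fQ SQ]] := @prime_avoiding A
  [set y | exists s n, ~ P s /\ y = s * x ^+ n] [set f * a | a in setT] An.
- split; first by exists 0; rewrite ?mulr0.
    by move=> _ _ [a _ <-] [b _ <-]; exists (a + b); rewrite ?mulrDr.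
  by move=> b _ [a _ <-]; exists (b * a) => //; rewrite mulrCA.
- by exists 1, 0%N; rewrite expr0 mulr1; split=> //; case: Pp.
- move=> _ _ [s [i [Ps ->]]] [t [j [Pt ->]]]; exists (s * t), (i + j)%N.
  by split; [exact: primeNM | rewrite exprD; ring].
- by move=> _ [s [n [Ps ->]]] [a _ e]; apply: noz; exists s, n, a.
have QP : Q `<` P.
  split.
    move=> y Qy; apply: contrapT => Py; apply: (SQ y) => //.
    by exists y, 0%N; rewrite expr0 mulr1.
  move=> /(_ x Px); apply: SQ.
  by exists 1, 1%N; rewrite expr1 mul1r; split=> //; case: Pp.
have PM : P `<` m.
  have Ppm : P `<=` m by case: Pp => Pi P1 _; exact: (local_sub An Am).
  by split=> // mP; apply: Pm; apply/seteqP.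
have Qmin : minimal_prime Q.
  split=> // Q' Q'p Q'Q; apply/seteqP; split=> //; apply: contrapT => QQ'.
  by apply: (dim2_chain dim2 Q'p Qp Pp (local_prime An Am)).
have Qf : Q f by apply: fQ; exists 1; rewrite ?mulr1.
have [s [n [Qs]]] := minimal_prime_zero_divisor An Qmin Qf.
by rewrite mulrC => /(regularX freg) s0; apply: Qs; rewrite s0; case: Qp => -[].
Qed.

(** One [s] serves all of [I]: it is the product of those found for the single generators. The
    conclusion has the form in which divisibility by [f] is tested on D(I). *)
Lemma prime_minimal_over_ideal I P : is_ideal I -> I f -> is_prime P -> P <> m ->
  I `<=` P -> exists2 s, ~ P s & forall Q, is_prime Q -> ~ I `<=` Q ->
    exists h a, ~ Q h /\ h * s = f * a.
Proof.
move=> Ii If Pp Pm IP; have [hs IE] := An Ii.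
have /choice[t tP] h : exists s, h \in hs -> ~ P s /\ exists n a, h ^+ n * s = f * a.
  have [hhs|] := boolP (h \in hs); last by exists 0.
  have Ph : P h by apply: IP; rewrite IE; exact: sub_ideal_span.
  have [s [n [a [Ps e]]]] := prime_minimal_over Pp Pm (IP _ If) Ph.
  by exists s => _; split=> //; exists n, a; rewrite mulrC.
exists (\prod_(h <- hs) t h).
  by apply: prime_prod => // h hhs; have [] := tP h hhs.
move=> Q Qp IQ; apply: contrapT => noh; apply: IQ.
rewrite IE; apply: ideal_span_sub; first by case: Qp.
move=> h /= hhs; apply: contrapT => Qh; apply: noh.
have [_ [n [a e]]] := tP h hhs.
exists (h ^+ n), (a * \prod_(y <- rem h hs) t y).
by split; [exact: primeNX | rewrite (big_rem h) //= [LHS]mulrA e mulrA].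
Qed.

End Dimension.

(** * Generation modulo an extended ideal, and completeness *)

Section Generation.
Variables (A B : comPzRingType) (phi : {rmorphism A -> B}).
Variables (n : nat) (e : 'I_n -> B).

Definition lin_comb (c : 'I_n -> A) : B := \sum_i phi (c i) * e i.

Lemma lin_combD c d : lin_comb (fun i => c i + d i) = lin_comb c + lin_comb d.
Proof.
by rewrite -big_split; apply: eq_bigr => i _; rewrite rmorphD mulrDl.
Qed.

Lemma lin_combN c : lin_comb (fun i => - c i) = - lin_comb c.
Proof. by rewrite -sumrN; apply: eq_bigr => i _; rewrite rmorphN mulNr. Qed.

Lemma lin_combZ a c : lin_comb (fun i => a * c i) = phi a * lin_comb c.
Proof. by rewrite mulr_sumr; apply: eq_bigr => i _; rewrite rmorphM mulrA. Qed.

Lemma lin_comb_ideal (L : set B) c : is_ideal L -> (forall i, L (phi (c i) * e i)) ->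
  L (lin_comb c).
Proof. by move=> Li Le; exact: ideal_sum. Qed.

(** The coefficients of an element of JB are moved into [J] at the cost of an error in [R']. The
    errors [R] and [R'] are mB and m^(k+1) B in successive approximation; later both are N, then
    both are 0. *)
Lemma ext_lin_comb (J : set A) (R R' : set B) : is_ideal J -> is_ideal R' ->
  (forall b, exists c, R (b - lin_comb c)) ->
  (forall a r, J a -> R r -> R' (phi a * r)) ->
  forall x, ext_ideal phi J x ->
    exists c, (forall i, J (c i)) /\ R' (x - lin_comb c).
Proof.
move=> Ji R'i gen JR.
have mulJ a b : J a -> exists c, (forall i, J (c i)) /\ R' (phi a * b - lin_comb c).
  move=> Ja; have [c cR] := gen b; exists (fun i => a * c i); split.
    by move=> i; exact: ideal_mulr.
  by rewrite lin_combZ -mulrBr; exact: JR.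
have ideal0 (T : comPzRingType) (L : set T) : is_ideal L -> L 0 by case.
apply: (ext_ideal_sub (Q := [set x | exists c, (forall i, J (c i)) /\
    R' (x - lin_comb c)])); last first.
  by move=> a /(mulJ a 1); rewrite mulr1.
have addJ x y : (exists c, (forall i, J (c i)) /\ R' (x - lin_comb c)) ->
    (exists c, (forall i, J (c i)) /\ R' (y - lin_comb c)) ->
    exists c, (forall i, J (c i)) /\ R' (x + y - lin_comb c).
  move=> [c [Jc xc]] [d [Jd yd]]; exists (fun i => c i + d i); split.
    by move=> i; exact: ideal_add.
  by rewrite lin_combD opprD addrACA; exact: ideal_add.
have J0 : exists c, (forall i, J (c i)) /\ R' (0 - lin_comb c).
  exists (fun=> 0); split; first by move=> i; exact: ideal0.
  rewrite /lin_comb big1 ?subrr; first exact: ideal0.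
  by move=> i _; rewrite rmorph0 mul0r.
split=> // b x [c [Jc xc]].
have [d [Jd xd]] : exists d, (forall i, J (d i)) /\ R' (b * lin_comb c - lin_comb d).
  rewrite /lin_comb mulr_sumr; apply: (big_ind (fun x => exists d,
    (forall i, J (d i)) /\ R' (x - lin_comb d))) => // i _.
  by rewrite mulrCA; exact: mulJ.
exists d; split=> //.
rewrite -(subrK (b * lin_comb c) (b * x)) -addrA -mulrBr.
by apply: ideal_add => //; exact: ideal_mull.
Qed.

End Generation.

Section Completeness.
Variables (A B : comPzRingType) (phi : {rmorphism A -> B}) (m : set A).
Hypothesis Ac : adically_complete m.
Variables (n : nat) (e : 'I_n -> B).
Hypothesis gen : forall b, exists c, ext_ideal phi m (b - lin_comb phi e c).

Lemma ideal_expS_sub k : ideal_exp m k.+1 `<=` ideal_exp m k.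
Proof.
apply: ideal_span_sub; first exact: ideal_exp_ideal.
by move=> _ [a [x [_ kx ->]]]; apply: ideal_mull => //; exact: ideal_exp_ideal.
Qed.

Lemma ideal_exp_le j k : (j <= k)%N -> ideal_exp m k `<=` ideal_exp m j.
Proof.
elim: k => [|k IH]; first by rewrite leqn0 => /eqP->.
rewrite leq_eqVlt ltnS => /orP[/eqP->//|/IH]; apply: subset_trans.
exact: ideal_expS_sub.
Qed.

(** Successive approximation with corrections in m^k. B need not be separated, so the combination
    represents [b] only modulo the intersection of the m^k B. *)
Lemma complete_generation b :
  exists c, forall k, ext_ideal phi (ideal_exp m k) (b - lin_comb phi e c).
Proof.
pose approx k c := ext_ideal phi (ideal_exp m k) (b - lin_comb phi e c).
pose T k := {c | approx k c}.
have step k (t : T k) : {u : T k.+1 | forall i, ideal_exp m k (sval u i - sval t i)}.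
  case: t => c ck; apply: cid.
  have mul_ext a r : ideal_exp m k a -> ext_ideal phi m r ->
      ext_ideal phi (ideal_exp m k.+1) (phi a * r).
    move=> ka mr; rewrite mulrC.
    have := ext_ideal_sub (phi := phi) (J := m)
      (Q := colon (ext_ideal phi (ideal_exp m k.+1)) (phi a)).
    move=> H; apply: H mr; first exact/colon_ideal/ext_ideal_ideal.
    move=> x mx; rewrite /colon /= -rmorphM; apply: ext_ideal_mem.
    by apply: sub_ideal_span; exists x, a.
  have [d [dk dc]] := ext_lin_comb (R := ext_ideal phi m)
    (R' := ext_ideal phi (ideal_exp m k.+1)) (ideal_exp_ideal m k)
    (ext_ideal_ideal _ _) gen mul_ext ck.
  have ck' : approx k.+1 (fun i => c i + d i).
    by rewrite /approx lin_combD opprD addrA.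
  by exists (exist (approx k.+1) _ ck') => i /=; rewrite addrAC subrr add0r.
have t0 : T 0%N.
  exists (fun=> 0); rewrite /approx (ideal_eqT (ext_ideal_ideal phi _)) //.
  by rewrite -(rmorph1 phi); exact: ext_ideal_mem.
pose s := nat_rect T t0 (fun k t => sval (step k t)).
have sS k i : ideal_exp m k (sval (s k.+1) i - sval (s k) i) := svalP (step k (s k)) i.
have sle i j k : (k <= j)%N -> ideal_exp m k (sval (s j) i - sval (s k) i).
  elim: j => [|j IH].
    by rewrite leqn0 => /eqP->; rewrite subrr; case: (ideal_exp_ideal m 0).
  rewrite leq_eqVlt ltnS => /orP[/eqP->|kj].
    by rewrite subrr; case: (ideal_exp_ideal m j.+1).
  rewrite -(subrK (sval (s j) i) (sval (s j.+1) i)) -addrA.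
  apply: ideal_add; [exact: ideal_exp_ideal | | exact: IH].
  by apply: (ideal_exp_le kj); exact: sS.
(* The limit agrees with the k-th approximation modulo m^k for every k: compare both with one late
   term of the sequence. *)
have lim i : {l | forall k, ideal_exp m k (l - sval (s k) i)}.
  apply: cid; case: Ac => _ /(_ (fun k => sval (s k) i)) [k|l lP].
    exists k => j j' kj kj'.
    rewrite -[X in _ (X - _)](subrK (sval (s k) i)) -addrA.
    apply: ideal_add; [exact: ideal_exp_ideal | exact: sle |].
    rewrite -opprB; apply: ideal_opp; [exact: ideal_exp_ideal | exact: sle].
  exists l => k; have [N NP] := lP k.
  rewrite -[l](subrK (sval (s (maxn N k)) i)) -addrA.
  apply: ideal_add; [exact: ideal_exp_ideal | | by apply: sle; exact: leq_maxr].
  rewrite -opprB; apply: ideal_opp; first exact: ideal_exp_ideal.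
  by apply: NP; exact: leq_maxl.
exists (fun i => sval (lim i)) => k.
have Ei := ext_ideal_ideal phi (ideal_exp m k).
rewrite -(subrK (lin_comb phi e (sval (s k))) b) -addrA.
apply: (ideal_add Ei); first exact: (svalP (s k)).
rewrite -lin_combN -lin_combD; apply: lin_comb_ideal => // i.
apply: (ideal_mulr _ Ei); apply: ext_ideal_mem; rewrite -opprB.
by apply: ideal_opp; [exact: ideal_exp_ideal | exact: (svalP (lim i))].
Qed.

End Completeness.

(* B plays the role of Gamma(D(I), O): by B_denom its elements are fractions
   near every point of D(I), and by B_div divisibility by f is local on D(I). *)
Section IdealTransform.
Variables (A B : comPzRingType) (phi : {rmorphism A -> B}) (m I : set A) (f : A).
Hypotheses (An : noetherian A) (Am : local_with m) (Ac : adically_complete m).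
Hypotheses (dim2 : has_krull_dim A 2) (Ii : is_ideal I) (If : I f).
Hypotheses (Iht : has_height I 1) (freg : forall x, f * x = 0 -> x = 0).
Hypotheses (phi_inj : injective phi) (Bn : noetherian B).
Hypothesis B_denom : forall b P, is_prime P -> ~ I `<=` P ->
  exists c a, ~ P c /\ phi c * b = phi a.
Hypothesis B_div : forall b, (forall P, is_prime P -> ~ I `<=` P ->
    exists h b', ~ P h /\ phi h * b = phi f * b') ->
  exists b', b = phi f * b'.
Hypothesis B_idem : forall e : B, e * e = e -> e = 0 \/ e = 1.

Let fB : set B := [set x | exists b, x = phi f * b].

Let fB_ideal : is_ideal fB.
Proof.
split; first by exists 0; rewrite mulr0.
  by move=> _ _ [b ->] [c ->]; exists (b + c); rewrite mulrDr.
by move=> a _ [b ->]; exists (a * b); rewrite mulrCA.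
Qed.

Let I_sub_m : I `<=` m.
Proof.
have [[P [[Pi P1 _] IP _]] _] := Iht.
by apply: subset_trans IP _; exact: (local_sub An Am).
Qed.

Let m_ideal : is_ideal m := local_ideal Am.

(** Needed at both ends of the dichotomy: for N = B it puts a power of m into IB, for N = 0 it
    identifies a height one prime with m. *)
Lemma prime_over_contraction P : is_prime P ->
  phi @^-1` (ext_ideal phi I) `<=` P -> P = m.
Proof.
move=> Pp IBP; apply: contrapT => Pm.
have IP : I `<=` P by move=> a Ia; apply: IBP; exact: ext_ideal_mem.
have [s Ps sP] := prime_minimal_over_ideal An Am dim2 freg Ii If Pp Pm IP.
apply: Ps; apply: IBP; rewrite /preimage /=.
have [Q Qp IQ|b ->] := @B_div (phi s).
  have [h [a [Qh e]]] := sP Q Qp IQ; exists h, (phi a).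
  by rewrite -!rmorphM e.
apply: (ideal_mulr _ (ext_ideal_ideal _ _)); exact: ext_ideal_mem.
Qed.

(** Prime avoidance takes place in A, so [g] is chosen regular modulo fB :&: A; this is possible
    because divisibility by [f] is local on D(I). Clearing denominators by [B_denom] carries
    regularity over to B/fB. *)
Lemma transform_regular_pair : exists g, [/\ I g,
  forall s n a, s * g ^+ n = f * a -> fB (phi s) &
  forall b, fB (phi g * b) -> fB b].
Proof.
have Ki := preimage_ideal phi fB_ideal.
have [x xI|g Ig gK] := regular_element An Ii Ki.
  apply: B_div => P Pp IP; apply: contrapT => noh; apply: IP => h Ih.
  apply: contrapT => Ph; apply: noh; exists h.
  by have [b hx] := xI h Ih; exists b; rewrite -rmorphM hx.
exists g; split=> //.
  move=> s n a e; have : fB (phi (g ^+ n * s)).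
    by exists (phi a); rewrite mulrC e rmorphM.
  by elim: n {e} => [|n IH]; rewrite ?expr0 ?mul1r // exprS -mulrA => /gK/IH.
move=> b [b' gb]; apply: B_div => P Pp IP; have [c [a [Pc cb]]] := B_denom b Pp IP.
exists c; suff [b'' e] : fB (phi a) by exists b''; rewrite cb.
by apply: gK; exists (phi c * b'); rewrite rmorphM -cb mulrCA gb mulrCA.
Qed.

(* The argument of Krull-Akizuki: the ideals D k form a descending chain over
   an ideal of finite colength, and once they are stationary
   g^n0 B <= A + g^(n0+1) B + f B, so that B/(f, g)B embeds in a cyclic module. *)
Lemma transform_generators : exists (n : nat) (e : 'I_n -> B),
  forall b, exists c, ext_ideal phi m (b - lin_comb phi e c).
Proof.
have [g [Ig gf gB]] := transform_regular_pair.
have gXB n b : fB (phi g ^+ n * b) -> fB b.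
  by elim: n b => [|n IH] b; rewrite ?expr0 ?mul1r // exprSr -mulrA => /IH/gB.
have fBM r : fB (phi f * r) by exists r.
pose K := phi @^-1` fB; have Ki : is_ideal K := preimage_ideal phi fB_ideal.
(* The trace on A of gA + g^k B + fB. *)
pose D k := [set a | exists w b, fB (phi a - phi g * phi w - phi g ^+ k * b)].
have [P Pp KP|k|k|k|n0 n0P] :=
  local_dcc (c := D) An Am (principal_ext_ideal g Ki).
(* A prime other than [m] over K + gA contains [f] and [g], so some [s] outside it has [s * g ^+ n]
   in fA; but then [s] is in [K]. *)
- apply: contrapT => Pm.
  have Kf : K f by exists 1; rewrite mulr1.
  have [||s [n [a [Ps e]]]] :=
    prime_minimal_over (x := g) An Am dim2 freg Pp Pm.
  + by apply: KP; exact: principal_ext_sub.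
  + by apply: KP; exact: principal_ext_mem.
  + by apply: Ps; apply: KP; apply: principal_ext_sub; exact: gf e.
- split.
  + by exists 0, 0; rewrite !rmorph0 !mulr0 !subr0; case: fB_ideal.
  + move=> a a' [w [b ab]] [w' [b' ab']]; exists (w + w'), (b + b').
    rewrite !rmorphD; have := ideal_add fB_ideal ab ab'; congr fB; ring.
  + move=> x a [w [b ab]]; exists (x * w), (phi x * b).
    rewrite !rmorphM; have := ideal_mull (phi x) fB_ideal ab; congr fB; ring.
- move=> _ [p [c [Kp ->]]]; exists c, 0; rewrite rmorphD rmorphM.
  by move: Kp; rewrite /K /preimage /=; congr fB; ring.
- move=> a [w [b ab]]; exists w, (phi g * b); rewrite exprS in ab.
  by move: ab; congr fB; ring.
pose step h b := exists u b', fB (phi g ^+ h * b - phi u - phi g ^+ h.+1 * b').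
have stepS h b : step h b -> step h.+1 b.
  move=> [u [b' ub']]; exists (g * u), b'; rewrite rmorphM !exprS.
  by have := ideal_mull (phi g) fB_ideal ub'; congr fB; rewrite !exprS; ring.
(* Modulo fB, g^(h+1) b = u + g^(h+2) b1. So u is in [D h.+1], hence in [D h.+2]: u = g w + g^(h+2)
   b2. As g is regular modulo fB, division by g gives g^h b = w + g^(h+1) (b1 + b2). *)
have step_down h b : (n0 <= h.+1)%N -> step h.+1 b -> step h b.
  move=> n0h [u [b1 ub1]].
  have [|w [b2 wb2]] := n0P _ n0h u.
    exists 0, (b - phi g * b1); rewrite rmorph0 mulr0 subr0.
    have := ideal_opp fB_ideal ub1; congr fB; rewrite !exprS; ring.
  exists w, (b1 + b2); apply: gB.
  by have := ideal_add fB_ideal ub1 wb2; congr fB; rewrite !exprS; ring.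
(* Some power of [g], depending on [b], carries [b] into A because [g] is in [I]. The descent then
   brings the exponent back to [n0], which is the same for all [b]. *)
have step0 b : step n0 b.
  have [h hb] : exists h, step h b.
    have Ji : is_ideal [set c | exists a, phi c * b = phi a].
      split.
      - by exists 0; rewrite rmorph0 mul0r.
      - move=> c d [a ca] [a' da']; exists (a + a').
        by rewrite !rmorphD mulrDl ca da'.
      - by move=> x c [a ca]; exists (x * a); rewrite !rmorphM -mulrA ca.
    have [P Pp JP|h [a ha]] := @radicalP _ _ g An Ji.
      have [IP|IP] := pselect (I `<=` P); first exact: IP.
      have [c [a [Pc ca]]] := B_denom b Pp IP.
      by exfalso; apply: Pc; apply: JP; exists a.
    exists h, a, 0; rewrite -rmorphXn ha subrr mulr0 subr0.
    by case: fB_ideal.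
  have : step (n0 + h)%N b.
    by elim: n0 {n0P step_down} => [|n IH] //; rewrite addSn; exact: stepS.
  elim: h {hb} => [|h IH]; first by rewrite addn0.
  by rewrite addnS => /(step_down _ _ (leqW (leq_addr _ _))).
(* This ideal is the trace on A of g^n0 B + fB. The [e i] are quotients of its generators by g^n0;
   as g is regular modulo fB, they generate B modulo (f, g)B. *)
have Ti : is_ideal [set a | exists b, fB (phi a - phi g ^+ n0 * b)].
  split.
  - by exists 0; rewrite rmorph0 mulr0 subr0; case: fB_ideal.
  - move=> a a' [b ab] [b' ab']; exists (b + b'); rewrite !rmorphD.
    by have := ideal_add fB_ideal ab ab'; congr fB; ring.
  - move=> x a [b ab]; exists (phi x * b); rewrite rmorphM.
    by have := ideal_mull (phi x) fB_ideal ab; congr fB; ring.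
have [s sE] := An Ti.
have /choice[e eP] (i : 'I_(size s)) : exists b, fB (phi s`_i - phi g ^+ n0 * b).
  suff : [set a | exists b, fB (phi a - phi g ^+ n0 * b)] s`_i by [].
  by rewrite sE; apply: sub_ideal_span; rewrite /= mem_nth.
exists (size s), e => b; have [u [b' ub']] := step0 b.
have : [set a | exists b, fB (phi a - phi g ^+ n0 * b)] u.
  exists (b - phi g * b'); have := ideal_opp fB_ideal ub'; congr fB.
  by rewrite !exprS; ring.
rewrite sE => /ideal_span_seqP[c uE]; exists c.
have : fB (phi u - phi g ^+ n0 * lin_comb phi e c).
  rewrite uE rmorph_sum /lin_comb mulr_sumr -sumrB.
  apply: ideal_sum => // i; rewrite rmorphM.
  by have := ideal_mull (phi (c i)) fB_ideal (eP i); congr fB; ring.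
move=> /(ideal_add fB_ideal ub') h.
have {h} [r rE] : fB (b - lin_comb phi e c - phi g * b').
  by apply: (gXB n0); move: h; congr fB; rewrite !exprS; ring.
have Ei := ext_ideal_ideal phi m.
rewrite -(subrK (phi g * b') (b - _)) rE; apply: (ideal_add Ei).
  by apply: (ideal_mulr _ Ei); apply: ext_ideal_mem; exact: I_sub_m.
by apply: (ideal_mulr _ Ei); apply: ext_ideal_mem; exact: I_sub_m.
Qed.

Lemma transform_unit_ideal : ext_ideal phi I 1.
Proof.
have [n [e gen]] := transform_generators.
have genN := complete_generation Ac gen.
pose N := [set x | forall k, ext_ideal phi (ideal_exp m k) x].
have Ni : is_ideal N.
  split=> [k|x y Nx Ny k|a x Nx k]; first by case: (ext_ideal_ideal phi (ideal_exp m k)).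
    exact: (ideal_add (ext_ideal_ideal phi _) (Nx k) (Ny k)).
  exact: (ideal_mull _ (ext_ideal_ideal phi _) (Nx k)).
have zero_ideal : is_ideal [set 0 : B].
  by split=> //= [_ _ -> ->|a _ ->]; rewrite ?addr0 ?mulr0.
have [d dm dN] := krull_intersection phi An Bn m_ideal.
have Li := principal_ext_ideal d Ni.
have extm x : ext_ideal phi m x -> exists c, (forall i, m (c i)) /\ N (x - lin_comb phi e c).
  by apply: (ext_lin_comb m_ideal Ni genN) => a r _; exact: (ideal_mull _ Ni).
(* Modulo dB, [e i] equals - (d - 1) * e i, which modulo N is a combination with coefficients in
   [m]. So [d'], a unit of A, multiplies every [e i] into N + dB, and N + dB = B. *)
have [|||i|d' [d'm d'L]] := det_trick (phi := phi) (J := m) (L := principal_ext N d)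
  (e := e) (x := 1) m_ideal.
- by case: Li.
- by move=> y z; exact: (ideal_add Li).
- by move=> a y; exact: (ideal_mull _ Li).
- have [c [mc cN]] := extm _ (ideal_mulr (e i) (ext_ideal_ideal phi m) dm).
  exists (fun j => - c j); split; first by move=> j; exact: ideal_opp.
  rewrite (_ : \sum_j _ = - lin_comb phi e c); last exact: lin_combN.
  exists (- ((d - 1) * e i - lin_comb phi e c)), (e i); split.
    exact: (ideal_opp Ni).
  by rewrite rmorph1; ring.
rewrite expr1n in d'm.
have [u ud'] : exists u, u * d' = 1.
  apply: (local_unit An Am) => md'; apply: (local_proper Am).
  by rewrite -(subKr d' 1); exact: ideal_sub.
have Le i : principal_ext N d (e i).
  rewrite -[e i]mul1r -(rmorph1 phi) -ud' rmorphM -mulrA.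
  exact: (ideal_mull _ Li).
have [x [c [Nx xE]]] : principal_ext N d 1.
  have [c cN] := genN 1; rewrite -(subrK (lin_comb phi e c) 1).
  apply: (ideal_add Li); first exact: principal_ext_sub.
  by apply: lin_comb_ideal => // i; exact: (ideal_mull _ Li).
(* x lies in N and 1 - x = d * c kills N *)
have xx : x * x = x.
  have {2}-> : x = 1 - d * c by rewrite xE addrK.
  by rewrite mulrBr mulr1 mulrA (mulrC x) (dN _ Nx) mul0r subr0.
have [x0|x1] := B_idem xx; last first.
  have [P Pp IP|k kI] := ideal_exp_sub (I := m) An
    (preimage_ideal phi (ext_ideal_ideal phi I)).
    by rewrite (prime_over_contraction Pp IP).
  rewrite -x1; exact: (ext_ideal_sub (ext_ideal_ideal phi I) kI (Nx k)).
(* Here 1 = d * c, while [d] kills N. *)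
have N0 y : N y -> y = 0.
  by move=> Ny; rewrite -[y]mul1r xE x0 add0r mulrAC (dN _ Ny) mul0r.
have [[Q [Qp IQ Qht]] _] := Iht.
suff mQ : Q = m by case: (maximal_not_height1 An Am dim2); rewrite -mQ.
apply: prime_over_contraction => // y yI.
(* Multiplication by [y] maps the generators [e i] of B to combinations with coefficients in [I].
   The resulting [a] kills all [e i], hence 1, so [a] = 0 and [y ^+ n] is in [I]. *)
have [|||i|a [Ia ae]] := det_trick (phi := phi) (J := I) (L := [set 0])
  (e := e) (x := y) Ii.
- by [].
- by move=> z t /= -> ->; rewrite addr0.
- by move=> a z /= ->; rewrite mulr0.
- have [b|a r _ ->|b [Ib bE]] := ext_lin_comb (e := e) (R := [set 0]) (R' := [set 0])
    Ii zero_ideal _ _ (ideal_mulr (e i) (ext_ideal_ideal phi I) yI).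
  + by have [b' b'N] := genN b; exists b'; exact: N0.
  + by rewrite mulr0.
  + by exists b.
suff a0 : a = 0.
  apply: (primeX (n := n) Qp); apply: IQ.
  rewrite -[y ^+ n]opprK; apply: (ideal_opp Ii).
  by rewrite a0 add0r in Ia.
apply: phi_inj; rewrite rmorph0 -[LHS]mulr1.
have [b /N0/subr0_eq->] := genN 1.
by rewrite /lin_comb mulr_sumr big1 // => i _; rewrite mulrCA ae mulr0.
Qed.

End IdealTransform.

(** * Affineness from the unit ideal *)

Lemma Spec_ext (A : comPzRingType) (x y : Spec A) :
  (forall a, pt_ideal x a <-> pt_ideal y a) -> x = y.
Proof.
case: x y => P Pp [Q Qp] /= PQ.
have {}PQ : P = Q by apply/seteqP; split=> a /PQ.
by case: _ / PQ Qp => Qp; congr MkSpec; exact: Prop_irrelevance.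
Qed.

Lemma frac_surj (A : comPzRingType) (x : Spec A) (g : local_ring x) :
  exists a s (hs : ~ pt_ideal x s), g = frac a hs.
Proof.
elim/quotW: g => -[a d]; exists a, (val d), (@denomP _ _ d).
by rewrite /frac (_ : mk_denom _ = d) //; exact: val_inj.
Qed.

Lemma bij_of_inj_surj (T U : Type) (f : T -> U) :
  injective f -> (forall u, exists t, f t = u) -> bijective f.
Proof.
move=> finj /choice[g gK]; exists g => // t; exact: finj.
Qed.

(** * Comparison of stalks *)

Section StalkMap.
Variables (A B : comPzRingType) (phi : {rmorphism A -> B}).

(** A relation instead of an equation between points, since an equation would force transport
    between the types [local_ring]. *)
Definition lies_over (P : Spec B) (x : Spec A) :=
  forall a, pt_ideal P (phi a) <-> pt_ideal x a.

Variables (P : Spec B) (x : Spec A) (Px : lies_over P x).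

Lemma lies_over_denom s : ~ pt_ideal x s -> ~ pt_ideal P (phi s).
Proof. by move=> xs /Px. Qed.

Definition stalk_map (g : local_ring x) : local_ring P :=
  frac (phi (repr g).1) (lies_over_denom (@denomP _ _ (repr g).2)).

Lemma stalk_map_frac a s (hs : ~ pt_ideal x s) :
  stalk_map (frac a hs) = frac (phi a) (lies_over_denom hs).
Proof.
rewrite /stalk_map; have /asboolP[w xw e] := frac_eq_repr (a, mk_denom hs).
apply/fracP; exists (phi w); first exact: lies_over_denom.
by rewrite -!rmorphM -rmorphB -rmorphM e rmorph0.
Qed.

Lemma stalk_mapB : zmod_morphism stalk_map.
Proof.
move=> g h; have [a [s [hs ->]]] := frac_surj g; have [b [t [ht ->]]] := frac_surj h.
rewrite fracN fracD !stalk_map_frac fracN fracD.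
apply/fracP; exists 1; first exact: denom1_proof.
rewrite !rmorphD !rmorphM !rmorphN; ring.
Qed.

Lemma stalk_mapM : monoid_morphism stalk_map.
Proof.
split.
  rewrite frac1 stalk_map_frac frac1; apply/fracP; exists 1; first exact: denom1_proof.
  by rewrite !rmorph1 subrr mulr0.
move=> g h; have [a [s [hs ->]]] := frac_surj g; have [b [t [ht ->]]] := frac_surj h.
rewrite fracM !stalk_map_frac fracM; apply/fracP; exists 1; first exact: denom1_proof.
rewrite !rmorphM; ring.
Qed.

HB.instance Definition _ := GRing.isZmodMorphism.Build _ _ stalk_map stalk_mapB.
HB.instance Definition _ := GRing.isMonoidMorphism.Build _ _ stalk_map stalk_mapM.

Hypotheses (phi_inj : injective phi)
  (denom_ex : forall b, exists c a, ~ pt_ideal x c /\ phi c * b = phi a).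

Lemma stalk_map_inj : injective stalk_map.
Proof.
move=> g h; have [a [s [hs ->]]] := frac_surj g; have [b [t [ht ->]]] := frac_surj h.
rewrite !stalk_map_frac => /fracP[w Pw e].
have [c [d [xc cw]]] := denom_ex w.
apply/fracP; exists d.
  by move=> /Px; rewrite -cw; apply: primeNM (pt_prime P) _ Pw => /Px.
apply: phi_inj; rewrite rmorph0 rmorphM rmorphB !rmorphM -cw -mulrA.
by rewrite e mulr0.
Qed.

Lemma stalk_map_surj h : exists g, stalk_map g = h.
Proof.
have [b [t [ht ->]]] := frac_surj h.
have [c [a [xc cb]]] := denom_ex b; have [d [a' [xd dt]]] := denom_ex t.
have xa' : ~ pt_ideal x a'.
  by move=> /Px; rewrite -dt; apply: primeNM (pt_prime P) _ ht => /Px.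
(* This is (a / c) / (a' / d), where b = a / c and t = a' / d. *)
exists (frac (a * d) (denomM_proof xc xa')); rewrite stalk_map_frac.
apply/fracP; exists 1; first exact: denom1_proof.
by rewrite !rmorphM -cb -dt; ring.
Qed.

End StalkMap.

Definition set_elt (T : Type) (S : set T) x (Sx : S x) : S :=
  exist (fun y => y \in S) x (mem_set Sx).

(** * The isomorphism of D(I) with Spec B *)

Section AffineOpen.
Variables (A B : comPzRingType) (phi : {rmorphism A -> B}) (I : set A).
Hypotheses (phi_inj : injective phi) (I_unit : ext_ideal phi I 1).
Hypothesis B_denom : forall b P, is_prime P -> ~ I `<=` P ->
  exists c a, ~ P c /\ phi c * b = phi a.

(** The trace on B of the maximal ideal of the local ring of A at [P]. *)
Definition prime_extension (P : set A) : set B :=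
  [set b | exists c a, [/\ ~ P c, P a & phi c * b = phi a]].

Lemma prime_extensionP P b c a : is_prime P -> ~ P c -> phi c * b = phi a ->
  prime_extension P b <-> P a.
Proof.
move=> Pp Pc cb; split=> [[c' [a' [Pc' Pa' cb']]]|Pa]; last by exists c, a.
have e : c' * a = c * a'.
  by apply: phi_inj; rewrite !rmorphM -cb -cb' mulrCA.
have [Pi _ PM] := Pp.
by have /PM[] : P (c' * a) by rewrite e; exact: ideal_mull.
Qed.

Lemma prime_extension_prime P : is_prime P -> ~ I `<=` P ->
  is_prime (prime_extension P).
Proof.
move=> Pp IP; have [Pi P1 _] := Pp; split; first split.
- by exists 1, 0; rewrite rmorph0 mulr0; split=> //; case: Pi.
- move=> b b' [c [a [Pc Pa cb]]] [c' [a' [Pc' Pa' cb']]].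
  exists (c * c'), (c' * a + c * a'); split; first exact: primeNM.
    by apply: ideal_add => //; exact: ideal_mull.
  by rewrite rmorphD !rmorphM -cb -cb'; ring.
- move=> b b' [c' [a' [Pc' Pa' cb']]]; have [c [a [Pc cb]]] := B_denom b Pp IP.
  exists (c * c'), (a * a'); split; [exact: primeNM | exact: ideal_mull |].
  by rewrite !rmorphM -cb -cb'; ring.
- by move=> [c [a [Pc Pa]]]; rewrite mulr1 => /phi_inj ca; apply: Pc; rewrite ca.
- move=> b b'.
  have [c [a [Pc cb]]] := B_denom b Pp IP.
  have [c' [a' [Pc' cb']]] := B_denom b' Pp IP.
  have bb' : phi (c * c') * (b * b') = phi (a * a') by rewrite !rmorphM -cb -cb'; ring.
  move=> /(prime_extensionP Pp (primeNM Pp Pc Pc') bb').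
  case: (Pp) => _ _ PM /PM[Pa|Pa']; [left | right].
    exact/(prime_extensionP Pp Pc cb).
  exact/(prime_extensionP Pp Pc' cb').
Qed.

Definition spec_ext (x : Spec A) (hx : D_ I x) : Spec B :=
  MkSpec (prime_extension_prime (pt_prime x) hx).

Lemma spec_ext_over x (hx : D_ I x) : lies_over phi (spec_ext hx) x.
Proof.
move=> a; apply: (prime_extensionP (c := 1) (pt_prime x)); last by rewrite rmorph1 mul1r.
by case: (pt_prime x).
Qed.

Lemma spec_ext_denom x (hx : D_ I x) b :
  exists c a, ~ pt_ideal x c /\ phi c * b = phi a.
Proof. exact: B_denom (pt_prime x) hx. Qed.

Lemma preimage_prime (P : Spec B) : is_prime (phi @^-1` pt_ideal P).
Proof.
have [Pi P1 PM] := pt_prime P; split; first exact: preimage_ideal.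
  by rewrite /preimage /= rmorph1.
by move=> a b; rewrite /preimage /= rmorphM => /PM.
Qed.

Definition spec_con (P : Spec B) : Spec A := MkSpec (preimage_prime P).

Lemma spec_con_over P : lies_over phi P (spec_con P). Proof. by []. Qed.

(** Here IB = B enters: a proper ideal of B cannot contain the image of [I]. *)
Lemma spec_con_in P : D_ I (spec_con P).
Proof.
have [Pi P1 _] := pt_prime P.
by move=> IP; apply: P1; exact: ext_ideal_sub Pi IP _ I_unit.
Qed.

Lemma spec_extK x (hx : D_ I x) : spec_con (spec_ext hx) = x.
Proof. by apply: Spec_ext => a; exact: spec_ext_over. Qed.

Lemma spec_conK P (hP : D_ I (spec_con P)) : spec_ext hP = P.
Proof.
apply: Spec_ext => b; have [c [a [Pc cb]]] := spec_ext_denom hP b.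
apply: iff_trans (prime_extensionP (pt_prime (spec_con P)) Pc cb) _.
rewrite /= /preimage /= -cb; have [Pi _ PM] := pt_prime P.
by split=> [/PM[]//|]; exact: ideal_mull.
Qed.

Let mem_U (u : D_ I) : D_ I (val u) := set_mem (valP u).
Arguments mem_U : clear implicits.

Definition to_spec (u : D_ I) : Spec B := spec_ext (mem_U u).
Definition of_spec (P : Spec B) : D_ I :=
  exist _ (spec_con P) (mem_set (@spec_con_in P)).

Lemma to_specK : cancel to_spec of_spec.
Proof. by move=> u; apply: val_inj; exact: spec_extK. Qed.

Lemma of_specK : cancel of_spec to_spec.
Proof. by move=> P; exact: spec_conK. Qed.

Lemma to_spec_image_open (V : set (Spec B)) : open V ->
  exists T, forall x (hx : D_ I x), V (spec_ext hx) <-> D_ T x.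
Proof.
(* On D(I), the locus where [b] does not vanish is the union of the D(c * a) over all presentations
   c * b = a; the factor [c] discards the points where the presentation says nothing about [b]. *)
move=> [S ->]; exists [set d | exists c a b, [/\ S b, phi c * b = phi a & d = c * a]].
move=> x hx; have xp := pt_prime x; split.
  move=> /D_P[b Sb xb]; have [c [a [xc cb]]] := spec_ext_denom hx b.
  apply/D_P; exists (c * a); first by exists c, a, b.
  by apply: primeNM => //; move=> /(prime_extensionP xp xc cb).
move=> /D_P[_ [c [a [b [Sb cb ->]]]] xca]; apply/D_P; exists b => //.
have xc : ~ pt_ideal x c.
  by move=> xc; apply: xca; apply: ideal_mulr => //; case: xp.
move=> /(prime_extensionP xp xc cb) xa; apply: xca.
by apply: ideal_mull => //; case: xp.
Qed.

Lemma to_spec_continuous : continuous to_spec.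
Proof.
apply/continuousP => V /to_spec_image_open[T VT]; exists (D_ T); first exact: open_D.
by apply/seteqP; split=> u h; exact/(VT (val u) (mem_U u)).
Qed.

Lemma of_spec_open (S : set A) : of_spec @^-1` (val @^-1` D_ S) = D_ (phi @` S).
Proof.
apply/seteqP; split=> P /D_P[a Sa Pa]; apply/D_P.
  by exists (phi a) => //; exists a.
by case: Sa Pa => b Sb <- Pb; exists b.
Qed.

Lemma of_spec_continuous : continuous of_spec.
Proof.
by apply/continuousP => _ [_ [S ->] <-]; rewrite of_spec_open; exact: open_D.
Qed.

Section Sections.
Variable V : set (Spec B).
Let W : set (Spec A) := val @` (to_spec @^-1` V).

Let W_in (y : W) : exists hx : D_ I (val y), V (spec_ext hx).
Proof. by have [u Vu uy] := set_mem (valP y); move: (valP y); rewrite -uy; exists (mem_U u). Qed.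

Let point (y : W) : V :=
  exist _ (spec_ext (projT1 (cid (W_in y)))) (mem_set (projT2 (cid (W_in y)))).

Let stalk_at x (hx : D_ I x) : local_ring x -> local_ring (spec_ext hx) :=
  stalk_map (spec_ext_over hx).

Let stalk_inv x (hx : D_ I x) (g : local_ring (spec_ext hx)) : local_ring x :=
  projT1 (cid (stalk_map_surj (spec_ext_over hx) (spec_ext_denom hx) g)).

Let stalk_invK x (hx : D_ I x) g : stalk_at hx (stalk_inv g) = g.
Proof. exact: projT2 (cid (stalk_map_surj _ _ g)). Qed.

Let stalk_at_inj x (hx : D_ I x) : injective (stalk_at hx).
Proof. exact: stalk_map_inj (spec_ext_denom hx). Qed.

Definition pull_fun (s : sections V) (y : W) : local_ring (val y) :=
  stalk_inv (s (point y)).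

(** Hides the choices made in [point] and [stalk_inv]: the stalk maps are injective, so this
    equation determines [pull_fun s] for any proofs of membership. *)
Lemma pull_funE s x (xW : x \in W) (hx : D_ I x) (hV : spec_ext hx \in V) :
  stalk_at hx (pull_fun s (exist _ x xW)) = s (exist _ (spec_ext hx) hV).
Proof.
rewrite /pull_fun /point /=; move: (cid _) => -[hx' hV'] /=.
move: hV; rewrite (Prop_irrelevance hx hx') => hV.
rewrite stalk_invK; congr (s (exist _ _ _)); exact: Prop_irrelevance.
Qed.

Lemma pull_proof (s : sections V) : locally_fraction (pull_fun s).
Proof.
move=> y; have [hx hV] := W_in y.
have [V' [oV' V'x [b [t st]]]] := sectionP s (set_elt hV).
have [T VT] := to_spec_image_open oV'.
have [c [a [xc cb]]] := spec_ext_denom hx b.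
have [d [a' [xd dt]]] := spec_ext_denom hx t.
exists (D_ T `&` D_ [set c * d]); split.
- by apply: openI; exact: open_D.
- split; first exact/(VT _ hx).
  by apply/D_P; exists (c * d) => //; exact: primeNM (pt_prime _) xc xd.
(* The fraction b / t rewritten over A, valid where both [c] and [d] are invertible. *)
exists (a * d), (c * a') => -[z zW] [/= Tz /D_P[_ -> zcd]].
have [hz hVz] := W_in (exist _ z zW); rewrite /= in hz hVz.
have zp := pt_prime z; have [zi _ _] := zp.
have zc : ~ pt_ideal z c by move=> zc; apply: zcd; exact: ideal_mulr.
have zd : ~ pt_ideal z d by move=> zd; apply: zcd; exact: ideal_mull.
have [ht sE] := st (set_elt hVz) (proj2 (VT z hz) Tz).
have za' : ~ pt_ideal z a' by move=> za'; apply: (ht); exact/(prime_extensionP zp zd dt).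
exists (primeNM zp zc za'); apply: (@stalk_at_inj _ hz).
rewrite (pull_funE _ _ (mem_set hVz)) sE /stalk_at stalk_map_frac.
apply/fracP; exists 1; first exact: denom1_proof.
by rewrite !rmorphM -cb -dt; ring.
Qed.

Definition pull (s : sections V) : sections W := MkSections (pull_proof s).

Lemma pull_zmod : zmod_morphism pull.
Proof.
move=> s t; apply: section_ext => -[x xW].
have [hx /mem_set hV] := W_in (exist _ x xW).
apply: (@stalk_at_inj _ hx).
rewrite [LHS](pull_funE _ _ hV) [RHS]stalk_mapB.
by rewrite ![stalk_map _ _](pull_funE _ _ hV).
Qed.

Lemma pull_monoid : monoid_morphism pull.
Proof.
split=> [|s t]; apply: section_ext => -[x xW];
  have [hx /mem_set hV] := W_in (exist _ x xW); apply: (@stalk_at_inj _ hx).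
  by rewrite [LHS](pull_funE _ _ hV) [RHS](stalk_mapM _).1.
rewrite [LHS](pull_funE _ _ hV) [RHS](stalk_mapM _).2.
by rewrite ![stalk_map _ _](pull_funE _ _ hV).
Qed.

HB.instance Definition _ := GRing.isZmodMorphism.Build _ _ pull pull_zmod.
HB.instance Definition _ := GRing.isMonoidMorphism.Build _ _ pull pull_monoid.

Lemma pull_inj : injective pull.
Proof.
move=> s t st; apply: section_ext => -[P PV].
have [x [hx PE]] : exists x (hx : D_ I x), P = spec_ext hx.
  by exists (spec_con P), (@spec_con_in P); rewrite spec_conK.
subst P.
have xW : x \in W.
  apply: mem_set; exists (set_elt hx) => //; rewrite /preimage /= /to_spec.
  rewrite (Prop_irrelevance (mem_U (set_elt hx)) hx); exact: set_mem.
by rewrite -!(pull_funE _ xW) -[pull_fun s]/(pull s : forall y : W, _) st.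
Qed.

Lemma pull_surj t : exists s, pull s = t.
Proof.
have conW (P : V) : W (spec_con (val P)).
  exists (of_spec (val P)) => //.
  by rewrite /preimage /= of_specK; exact: set_mem (valP P).
(* The inverse of [pull]: the germ of [t] at the contraction of [P], carried to B by the stalk
   map. *)
pose s0 (P : V) : local_ring (val P) :=
  stalk_map (spec_con_over (val P)) (t (set_elt (conW P))).
have s0P : locally_fraction s0.
  move=> P; have [_ [[S ->] SP [a [f tE]]]] := sectionP t (set_elt (conW P)).
  exists (D_ (phi @` S)); split; first exact: open_D.
    by rewrite -of_spec_open.
  exists (phi a), (phi f) => Q; rewrite -of_spec_open => SQ.
  have [hf e] := tE (set_elt (conW Q)) SQ.
  by exists (lies_over_denom (spec_con_over (val Q)) hf); rewrite /s0 e stalk_map_frac.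
exists (MkSections s0P); apply: section_ext => -[x xW].
have [hx /mem_set hV] := W_in (exist _ x xW); apply: (@stalk_at_inj _ hx).
rewrite [LHS](pull_funE _ _ hV) /= /s0 /=.
(* The proofs that depend on the contracted point are generalized so that [spec_extK] can replace it
   by [x]. *)
move: (conW _) (spec_con_over _) => /=; rewrite spec_extK => xW' over.
rewrite (Prop_irrelevance over (spec_ext_over hx)) /set_elt.
by rewrite (Prop_irrelevance (mem_set xW') xW).
Qed.

Lemma pull_bij : bijective pull.
Proof. exact: bij_of_inj_surj pull_inj pull_surj. Qed.

End Sections.

Lemma pull_restrict (V V' : set (Spec B)) (h : V' `<=` V) (s : sections V) :
  pull (restrict h s) =
  restrict (image_subset val (preimage_subset (f := to_spec) h)) (pull s).
Proof.
apply: section_ext => -[x xW].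
have [u V'u ux] := set_mem xW.
have hx : D_ I x by rewrite -ux; exact: mem_U.
have hV' : V' (spec_ext hx).
  move: hx; rewrite -ux => hx; rewrite (Prop_irrelevance hx (mem_U u)); exact: V'u.
apply: (@stalk_map_inj _ _ _ _ _ (spec_ext_over hx) phi_inj (spec_ext_denom hx)).
transitivity (restrict h s (set_elt hV')).
  exact: pull_funE.
set k := image_subset _ _; have xW' := mem_set (k x (set_mem xW)).
have -> : restrict k (pull s) (exist _ x xW) = pull_fun s (exist _ x xW').
  by rewrite /= /incl_set /=; congr (pull_fun s (exist _ _ _)); exact: Prop_irrelevance.
rewrite [RHS](pull_funE s xW' (mem_set (h _ hV'))) /= /incl_set /=.
by congr (s (exist _ _ _)); exact: Prop_irrelevance.
Qed.

Lemma unit_ideal_affine :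
  is_affine (@open_subspace (Spec_space A) (D_ I) (open_D I)).
Proof.
exists B; split.
apply: (@RsIso (open_subspace (X := Spec_space A) (open_D I)) (Spec_space B)
  to_spec of_spec to_specK of_specK to_spec_continuous of_spec_continuous
  (fun V _ => @pull V : {rmorphism _ -> _})) => [V _|V V' _ _ h s].
  exact: pull_bij.
exact: pull_restrict.
Qed.

End AffineOpen.

(** * Functions on D(I) *)

Section Stalk.
Variables (A : comPzRingType) (x : Spec A).

Lemma frac_eq0 a s (hs : ~ pt_ideal x s) :
  frac a hs = 0 <-> exists2 w, ~ pt_ideal x w & w * a = 0.
Proof.
by rewrite frac0; apply: iff_trans (fracP _ _ _ _) _; rewrite mulr1 mul0r subr0.
Qed.

Lemma frac_congr a s (hs : ~ pt_ideal x s) b t (ht : ~ pt_ideal x t) :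
  a * t = b * s -> frac a hs = frac b ht.
Proof.
move=> e; apply/fracP; exists 1; first exact: denom1_proof.
by rewrite e subrr mulr0.
Qed.

(** Idempotency of a / s reads w a s (a - s) = 0 with [w] outside the prime, and [a] and [a - s] are
    not both in the prime since [s] is not. *)
Lemma frac_idempotent (g : local_ring x) : g * g = g -> g = 0 \/ g = 1.
Proof.
have [a [s [hs ->]]] := frac_surj g; rewrite fracM => /fracP[w xw e].
have [a_in|a_notin] := pselect (pt_ideal x a); last first.
  right; rewrite frac1; apply/fracP; exists (w * a * s).
    by do 2![apply: primeNM (pt_prime x) _ _ => //].
  by rewrite -e; ring.
left; apply/frac_eq0; exists (w * s * (a - s)); last by rewrite -e; ring.
apply: primeNM (pt_prime x) _ _; first exact: primeNM (pt_prime x) xw hs.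
have [xi _ _] := pt_prime x; move=> as_in; apply: hs.
by rewrite -(subKr a s); exact: (ideal_sub xi).
Qed.

End Stalk.

Lemma open_basis (A : comPzRingType) (V : set (Spec A)) :
  (forall x, V x -> exists2 h, ~ pt_ideal x h & D_ [set h] `<=` V) -> open V.
Proof.
move=> Vb; exists [set h | D_ [set h] `<=` V]; apply/seteqP; split=> x.
  by move=> /Vb[h xh hV]; apply/D_P; exists h.
by move=> /D_P[h hV xh]; apply: hV; apply/D_P; exists h.
Qed.

(** * Sections as fractions, and divisibility by a regular element *)

Section Sections.
Variables (A : comPzRingType) (I : set A).
Hypotheses (An : noetherian A) (Ii : is_ideal I).
Notation B := (sections (D_ I)).
Notation phi := (const_section (D_ I)).
Implicit Types (b s : B) (P : set A).

Lemma const_sectionM a s (x : D_ I) :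
  (phi a * s) x = frac a (@denom1_proof _ (val x)) * s x.
Proof. by []. Qed.

(** The denominator itself is made to cut out the neighbourhood: [t] vanishes nowhere on D(i * k),
    so it divides a power of [i * k], which becomes the denominator. *)
Lemma section_local_form s P (Pp : is_prime P) (IP : ~ I `<=` P) :
  exists h a, [/\ I h, ~ P h & forall (y : D_ I) (hy : ~ pt_ideal (val y) h),
    s y = frac a hy].
Proof.
have [V [[S ->] /D_P[k Sk Pk] [a [t sE]]]] :=
  sectionP s (@set_elt _ (D_ I) (MkSpec Pp) IP).
rewrite /= in Pk.
have [i Ii' Pi] : exists2 i, I i & ~ P i.
  by move/existsNP: IP => [i /not_implyP[? ?]]; exists i.
have Pik : ~ P (i * k) by exact: primeNM.
have Iik : I (i * k) by exact: ideal_mulr.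
have sE' (y : D_ I) : ~ pt_ideal (val y) (i * k) ->
    exists ht : ~ pt_ideal (val y) t, s y = frac a ht.
  move=> yik; apply: sE; apply/D_P; exists k => // yk; apply: yik.
  by case: (pt_prime (val y)) => yi _ _; exact: ideal_mull.
have ti : is_ideal [set t * c | c in setT].
  split; first by exists 0; rewrite ?mulr0.
    by move=> _ _ [c _ <-] [d _ <-]; exists (c + d); rewrite ?mulrDr.
  by move=> d _ [c _ <-]; exists (d * c) => //; rewrite mulrCA.
have [Q Qp tQ|n [c _ tc]] := radicalP (x := i * k) An ti.
  apply: contrapT => Qik.
  have IQ : ~ I `<=` Q by move=> /(_ _ Iik).
  have [Qt _] := sE' (@set_elt _ (D_ I) (MkSpec Qp) IQ) Qik.
  by apply: Qt; apply: tQ; exists 1; rewrite ?mulr1.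
(* Since [n] may be 0, one more factor is needed for the denominator to lie in [I] and to vanish
   wherever [i * k] does. *)
exists ((i * k) ^+ n.+1), (a * c * (i * k)); split.
- by rewrite exprS; exact: ideal_mulr.
- exact: primeNX.
move=> y hy; have [|ht ->] := sE' y.
  move=> yik; apply: hy; rewrite exprS; case: (pt_prime (val y)) => yi _ _.
  exact: ideal_mulr.
by apply: frac_congr; rewrite exprSr -tc; ring.
Qed.

(* Quasi-compactness of D(I) makes the exponent uniform. *)
Lemma section_killed s h : (forall y : D_ I, ~ pt_ideal (val y) h -> s y = 0) ->
  exists n, forall y : D_ I, (phi (h ^+ n) * s) y = 0.
Proof.
move=> s0.
(* The ideal of those [c] for which h^n s vanishes on D(c). A bound for this ascending chain is the
   uniform exponent. *)
pose G n := [set c | forall y : D_ I, ~ pt_ideal (val y) c -> (phi (h ^+ n) * s) y = 0].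
have Gi n : is_ideal (G n).
  split=> [y|c d Gc Gd y ycd|c d Gd y ycd]; have [yi _ _] := pt_prime (val y).
  - by case: yi => y0 _ _ /(_ y0).
  - have [yc|] := pselect (pt_ideal (val y) c); last exact: Gc.
    by apply: Gd => yd; apply: ycd; exact: ideal_add.
  - by apply: Gd => yd; apply: ycd; exact: ideal_mull.
have GS n : G n `<=` G n.+1.
  by move=> c Gc y /Gc e; rewrite exprS rmorphM -mulrA const_sectionM e mulr0.
have [n nP] := noetherian_acc An Gi GS.
have Grad i : I i -> exists j, G n (i ^+ j).
  move=> Ii'; apply: radicalP => // P Pp GP; apply: contrapT => Pi.
  have IP : ~ I `<=` P by move=> /(_ i Ii').
  have [k [a [Ik Pk sE]]] := section_local_form s Pp IP.
  have annk : is_ideal (annihilator a).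
    split; rewrite /annihilator /=; first by rewrite mul0r.
      by move=> c d ca da; rewrite mulrDl ca da addr0.
    by move=> c d da; rewrite -mulrA da mulr0.
  (* On D(k) the section is a / k; as it vanishes on D(k * h), some power of [k * h] kills [a]. *)
  have [Q Qp aQ|N aN] := radicalP (x := k * h) An annk.
    apply: contrapT => Qkh; have [Qi _ _] := Qp.
    have Qk : ~ Q k by move=> Qk; apply: Qkh; exact: ideal_mulr.
    have Qh : ~ Q h by move=> Qh; apply: Qkh; exact: ideal_mull.
    have IQ : ~ I `<=` Q by move=> /(_ k Ik).
    have := s0 (@set_elt _ (D_ I) (MkSpec Qp) IQ) Qh.
    rewrite (sE (@set_elt _ (D_ I) (MkSpec Qp) IQ) Qk) => /frac_eq0[w Qw wa].
    exact/Qw/aQ.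
  have GNk : G N k.
    move=> y yk; rewrite const_sectionM (sE y yk) fracM; apply/frac_eq0.
    exists (k ^+ N); first exact: primeNX (pt_prime _) yk.
    by rewrite mulrA -exprMn.
  apply/Pk/GP; have [Nn|nN] := leqP N n; first exact: (ascending_le GS Nn).
  exact: nP (ltnW nN) _ GNk.
exists n => y; have /existsNP[i /not_implyP[Ii' yi]] := set_mem (valP y).
have [j Gj] := Grad i Ii'; apply: Gj; exact: primeNX (pt_prime _) yi.
Qed.

(** Near [P] the section is a / h, so [phi h * s - phi a] vanishes on D(h) and a power of [h] kills
    it on all of D(I). *)
Lemma section_denominator s P : is_prime P -> ~ I `<=` P ->
  exists c a, ~ P c /\ phi c * s = phi a.
Proof.
move=> Pp IP; have [h [a [Ih Ph sE]]] := section_local_form s Pp IP.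
have [y yh|n n0] := @section_killed (phi h * s - phi a) h.
  change (frac h (@denom1_proof _ (val y)) * s y - frac a (@denom1_proof _ (val y)) = 0).
  rewrite (sE y yh) fracM; apply/eqP; rewrite subr_eq0; apply/eqP.
  by apply: frac_congr; ring.
exists (h ^+ n * h), (h ^+ n * a); split.
  by apply: primeNM => //; exact: primeNX.
apply/eqP; rewrite -subr_eq0; apply/eqP; rewrite !rmorphM -mulrA -mulrBr.
by apply: section_ext => y; rewrite n0.
Qed.

Variable f : A.
Hypotheses (If : I f) (freg : forall x, f * x = 0 -> x = 0).

(** An element of A vanishing on D(f) is killed by a power of the regular element [f]. *)
Lemma const_section_inj : injective phi.
Proof.
move=> a b ab; apply/eqP; rewrite -subr_eq0; apply/eqP; set c := a - b.
have c0 : phi c = 0 by rewrite rmorphB /= ab subrr.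
have ci : is_ideal (annihilator c).
  split; rewrite /annihilator /=; first by rewrite mul0r.
    by move=> x y xc yc; rewrite mulrDl xc yc addr0.
  by move=> x y yc; rewrite -mulrA yc mulr0.
have [P Pp cP|n /regularX] := radicalP (x := f) An ci; last exact.
apply: contrapT => Pf; have IP : ~ I `<=` P by move=> /(_ f If).
have := congr1 (fun s : B => s (@set_elt _ (D_ I) (MkSpec Pp) IP)) c0.
by move=> /frac_eq0[w Pw wc]; apply: Pw; exact: cP.
Qed.

Lemma stalk_regular (x : Spec A) (g h : local_ring x) :
  frac f (@denom1_proof _ x) * g = frac f (@denom1_proof _ x) * h -> g = h.
Proof.
have [a [s [hs ->]]] := frac_surj g; have [b [t [ht ->]]] := frac_surj h.
rewrite !fracM => /fracP[w xw e]; apply/fracP; exists w => //.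
apply: freg; rewrite -e; ring.
Qed.

(** Quotients by the regular element [f] are unique in every stalk, so the local quotients agree and
    form a section. *)
Lemma section_division s : (forall P, is_prime P -> ~ I `<=` P ->
    exists h b, ~ P h /\ phi h * s = phi f * b) ->
  exists b, s = phi f * b.
Proof.
move=> sdiv.
have loc (x : D_ I) : exists k a, ~ pt_ideal (val x) k /\
    forall (y : D_ I) (hy : ~ pt_ideal (val y) k),
      s y = frac f (@denom1_proof _ (val y)) * frac a hy.
  have xI : ~ I `<=` pt_ideal (val x) := set_mem (valP x).
  have [h [b [xh hb]]] := sdiv _ (pt_prime (val x)) xI.
  have [k [a [Ik xk bE]]] := section_local_form b (pt_prime (val x)) xI.
  exists (h * k), a; split; first exact: primeNM (pt_prime _) xh xk.
  move=> y yhk; have [yi _ _] := pt_prime (val y).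
  have yh : ~ pt_ideal (val y) h by move=> yh; apply: yhk; exact: ideal_mulr.
  have yk : ~ pt_ideal (val y) k by move=> yk; apply: yhk; exact: ideal_mull.
  have : (phi h * s) y = (phi f * b) y by rewrite hb.
  rewrite !const_sectionM (bE y yk); have [c [t [ht ->]]] := frac_surj (s y).
  rewrite !fracM => /fracP[w yw e]; apply/fracP; exists w => //.
  by rewrite -e; ring.
have ex (x : D_ I) : exists v, s x = frac f (@denom1_proof _ (val x)) * v.
  by have [k [a [xk /(_ x xk)e]]] := loc x; exists (frac a xk).
pose v (x : D_ I) := projT1 (cid (ex x)).
have vE (x : D_ I) : s x = frac f (@denom1_proof _ (val x)) * v x := projT2 (cid (ex x)).
have vP : locally_fraction v.
  move=> x; have [k [a [xk kE]]] := loc x.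
  exists (D_ [set k]); split; [exact: open_D | by apply/D_P; exists k |].
  exists a, k => y /D_P[_ -> yk]; exists yk.
  by apply: stalk_regular; rewrite -vE; exact: kE.
by exists (MkSections vP); apply: section_ext => x; exact: vE.
Qed.

End Sections.

(** Stalks have only trivial idempotents, so D(I) is the disjoint union of the open loci where [e]
    is 0 and where it is 1. An empty D(I) falls under [e] = 0. *)
Lemma section_idempotent (A : comPzRingType) (I : set A) (e : sections (D_ I)) :
  connected (D_ I) -> e * e = e -> e = 0 \/ e = 1.
Proof.
move=> Uconn ee.
have e01 (x : D_ I) : e x = 0 \/ e x = 1.
  by apply: frac_idempotent; exact: (congr1 (fun s : sections (D_ I) => s x) ee).
pose W (z : forall x : Spec A, local_ring x) :=
  [set x | exists hx : D_ I x, e (set_elt hx) = z x].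
have eE x (hx : x \in D_ I) (hx' : D_ I x) : e (exist _ x hx) = e (set_elt hx').
  by congr (e (exist _ _ _)); exact: Prop_irrelevance.
have Wopen c : open (W (fun x => frac c (@denom1_proof _ x))).
  apply: open_basis => x [hx ex].
  have [_ [[S ->] /D_P[k Sk xk] [a [t eV]]]] := sectionP e (set_elt hx).
  have [ht] : exists ht : ~ pt_ideal x t, e (set_elt hx) = frac a ht.
    by apply: (eV (set_elt hx)); apply/D_P; exists k.
  rewrite ex => /esym/fracP[w xw ew].
  have [i Ii xi] := (D_P I x).1 hx.
  (* One [w] witnesses the equality of germs, which therefore persists on D(w); [i] keeps the points
     in D(I), and [k] keeps them where [e] is a / t. *)
  exists (w * (i * k)).
    by apply: primeNM (pt_prime x) xw _; apply: primeNM (pt_prime x) _ _.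
  move=> y /D_P[_ -> ywik]; have [yi _ _] := pt_prime y.
  have yw : ~ pt_ideal y w by move=> yw; apply: ywik; exact: ideal_mulr.
  have yik : ~ pt_ideal y (i * k) by move=> yik; apply: ywik; exact: ideal_mull.
  have hy : D_ I y by apply/D_P; exists i => // yi'; apply: yik; exact: ideal_mulr.
  exists hy; have [|ht' ->] := eV (set_elt hy).
    by apply/D_P; exists k => // yk; apply: yik; exact: ideal_mull.
  by apply/fracP; exists w.
pose W1 := W (fun x => frac 1 (@denom1_proof _ x)).
pose W0 := W (fun x => frac 0 (@denom1_proof _ x)).
have W01 x : W0 x -> ~ W1 x.
  move=> [hx e0] [hx' e1]; move: e1; rewrite -(eE x (mem_set hx)) e0.
  move=> /fracP[w xw]; rewrite mulr1 mul1r sub0r mulrN1 => /eqP.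
  by rewrite oppr_eq0 => /eqP w0; apply: xw; rewrite w0; case: (pt_prime x) => -[].
have [[x [hx ex]]|noW1] := pselect (W1 !=set0).
  have W1E : W1 = D_ I.
    apply: Uconn; first by exists x; exists hx.
      exists W1 => //; first exact: Wopen.
      by apply/seteqP; split=> [y|y []] //; move=> h; split=> //; case: h.
    exists (~` W0); first by apply: open_closedC; exact: Wopen.
    apply/seteqP; split=> y.
      by move=> h; split; [case: h | move=> /W01].
    move=> [hy W0y]; exists hy; have [e0|//] := e01 (set_elt hy).
    by exfalso; apply: W0y; exists hy.
  right; apply: section_ext => -[y yU]; have : W1 y by rewrite W1E; exact: set_mem.
  by move=> [hy e1]; rewrite (eE y yU hy).
left; apply: section_ext => -[y yU]; rewrite (eE y yU (set_mem yU)).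
have [//|e1] := e01 (set_elt (set_mem yU)).
by exfalso; apply: noW1; exists y, (set_mem yU).
Qed.

(** If [I] killed a nonzero element, it would lie in an associated prime, which S1 makes minimal,
    hence of height 0. *)
Lemma S1_regular_element (A : comPzRingType) (I : set A) : noetherian A ->
  serre_S1 A -> is_ideal I -> has_height I 1 ->
  exists2 f, I f & forall x, f * x = 0 -> x = 0.
Proof.
move=> An S1 Ii [_ Iht]; have zi : is_ideal [set 0 : A].
  by split=> //= [_ _ -> ->|a _ ->]; rewrite ?addr0 ?mulr0.
apply: (regular_element An Ii zi) => x Ix; apply: contrapT => x0.
have [y [y0 xy ymax]] := colon_max An zi x0.
have yp := colon_max_prime zi y0 ymax.
have [_ ymin] : minimal_prime (colon [set 0] y) by apply: S1; split=> //; exists y.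
have Iy : I `<=` colon [set 0] y by move=> a Ia; apply: xy; exact: Ix.
suff ht0 : prime_has_height (colon [set 0] y) 0 by have := Iht _ _ yp Iy ht0.
split; first by exists (fun=> colon [set 0] y); split.
move=> [|k] c [cp cS] ck //.
have [ckk] := cS k (leqnn _); rewrite ck in ckk * => - [].
by rewrite (ymin (c k) _ ckk) //; apply: cp.
Qed.

Theorem corollary2p3 (A : comNzRingType) (I : set A)
    (A_local : complete_local A) (A_noeth : noetherian A)
    (A_dim : has_krull_dim A 2) (A_S1 : serre_S1 A)
    (I_ideal : is_ideal I) (I_height : has_height I 1)
    (U_connected : connected (D_ I))
    (Gamma_finite_type : finite_type (const_section (D_ I))) :
  is_affine (@open_subspace (Spec_space A) (D_ I) (open_D I)).
Proof.
have [m Am Ac] := A_local.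
have [f If freg] := S1_regular_element A_noeth A_S1 I_ideal I_height.
have phi_inj := const_section_inj A_noeth If freg.
have denom := section_denominator A_noeth I_ideal.
apply: (unit_ideal_affine phi_inj _ denom).
apply: (transform_unit_ideal A_noeth Am Ac A_dim I_ideal If I_height freg phi_inj
  (finite_type_noetherian A_noeth Gamma_finite_type) denom).
  by move=> b; exact: section_division freg b.
by move=> e; exact: section_idempotent.
Qed.
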